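(* Let $0<\varepsilon<1/3$ and let $A=U\Sigma V^\top$ be (the SVD of) a real $n\times m$ matrix of rank $r$ with $n\ge m$. (i)(a) Let $R$ be a $t\times n$ random sign matrix rescaled by $1/\sqrt t$ and set $\tilde A=RA$. If $t=\Omega(r/\varepsilon^2)$, then with high probability $\|A-P_{\tilde A,k}(A)\|_2\le(1+\varepsilon)\|A-A_k\|_2$ for every $k=1,\dots,r$. (i)(b) Let $R$ be a $t\times n$ random Gaussian matrix rescaled by $1/\sqrt t$ and set $\tilde A=RA$. If $t=\Omega(k/\varepsilon^2)$, then with high probability $\|A-P_{\tilde A,k}(A)\|_2\le\big(2+\varepsilon\sqrt{(r-k)/k}\big)\|A-A_k\|_2$. (ii) Let $p_i=\|U_{(i)}\|_2^2/r$, a probability distribution on $[n]$. Let $\tilde A$ be the $t\times m$ matrix formed row by row by taking $t$ i.i.d. indices $i_1,\dots,i_t$ from $(p_i)$ and setting the $j$-th row to $A_{(i_j)}/\sqrt{t\,p_{i_j}}$. If $t=\Omega(r\log(r/\varepsilon^2)/\varepsilon^2)$, then with high probability $\|A-P_{\tilde A,k}(A)\|_2\le(1+\varepsilon)\|A-A_k\|_2$ for every $k=1,\dots,r$.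
   Context: In the SVD $A=U\Sigma V^\top$, $U\in\mathbb{R}^{n\times r}$ has orthonormal columns and $U_{(i)}$ is its $i$-th row; $A_{(i)}$ is the $i$-th row of $A$. $A_k$ is the best rank-$k$ approximation of $A$. For matrices $A,C$ with the same number of columns, $P_C(A)=AC^{+}C$ ($C^{+}$ the Moore–Penrose pseudo-inverse) and $P_{C,k}(A)$ is the best rank-$k$ approximation of $P_C(A)$. A random sign matrix has i.i.d. entries uniform on $\{\pm1\}$; a random Gaussian matrix has i.i.d. standard Gaussian entries. $\|\cdot\|_2$ is the spectral norm. $\Omega(\cdot)$ hides sufficiently large absolute constants. *)

(* Defs.v *)
From mathcomp Require Import all_boot all_order all_algebra.
From mathcomp Require Import all_classical all_reals all_analysis.
Import Order.TTheory GRing.Theory Num.Theory.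
Import numFieldNormedType.Exports.

Set Implicit Arguments.
Unset Strict Implicit.
Unset Printing Implicit Defensive.

Local Open Scope classical_set_scope.
Local Open Scope ring_scope.

Section LinearAlgebra.
Context {R : realType}.

(* Only applied to row and column vectors (it is the Frobenius norm in
   general). *)
Definition l2norm p q (v : 'M[R]_(p, q)) : R :=
  Num.sqrt (\sum_i \sum_j v i j ^+ 2).

Definition spectral_norm n m (A : 'M[R]_(n, m)) : R :=
  sup [set l2norm (A *m x) | x in [set x : 'cV[R]_m | l2norm x <= 1]].

(* Thin SVD: r is the rank of A, so the r singular values are positive. *)
Definition is_svd n m r (A : 'M[R]_(n, m)) (U : 'M[R]_(n, r)) (s : 'rV[R]_r)
    (V : 'M[R]_(m, r)) : Prop :=
  [/\ U^T *m U = 1%:M, V^T *m V = 1%:M,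
      forall i, 0 < s 0 i,
      forall i j : 'I_r, (i <= j)%N -> s 0 j <= s 0 i
    & A = U *m diag_mx s *m V^T].

(* The minimizer is not unique in general, hence a relation. *)
Definition best_rank_approx n m (k : nat) (A B : 'M[R]_(n, m)) : Prop :=
  (\rank B <= k)%N /\
  forall C : 'M[R]_(n, m), (\rank C <= k)%N ->
    spectral_norm (A - B) <= spectral_norm (A - C).

Definition moore_penrose n m (C : 'M[R]_(n, m)) (X : 'M[R]_(m, n)) : Prop :=
  [/\ C *m X *m C = C, X *m C *m X = X,
      (C *m X)^T = C *m X & (X *m C)^T = X *m C].

(* The default value 0 is never used: see [mpinvP] and [mpinv_unique]. *)
Definition mpinv n m (C : 'M[R]_(n, m)) : 'M[R]_(m, n) :=
  xget 0 [set X | moore_penrose C X].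

Definition proj_rows n m t (C : 'M[R]_(t, m)) (A : 'M[R]_(n, m)) :
  'M[R]_(n, m) := A *m mpinv C *m C.

(* || A - P_{C,k}(A) ||_2 <= a || A - A_k ||_2, for every choice of the best
   rank-k approximations A_k of A and P_{C,k}(A) of P_C(A). *)
Definition projected_approx_le n m t (A : 'M[R]_(n, m)) (C : 'M[R]_(t, m))
    (k : nat) (a : R) : Prop :=
  forall Ak B : 'M[R]_(n, m),
    best_rank_approx k A Ak -> best_rank_approx k (proj_rows C A) B ->
    spectral_norm (A - B) <= a * spectral_norm (A - Ak).

Definition leverage_prob n r (U : 'M[R]_(n, r)) (i : 'I_n) : R :=
  l2norm (row i U) ^+ 2 / r%:R.

Definition sampled_rows n m t (A : 'M[R]_(n, m)) (p : 'I_n -> R)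
    (idx : 'I_t -> 'I_n) : 'M[R]_(t, m) :=
  \matrix_(j < t) ((Num.sqrt (t%:R * p (idx j)))^-1 *: row (idx j) A).

Lemma gram_unit p q (G : 'M[R]_(p, q)) : row_free G -> G *m G^T \in unitmx.
Proof.
move=> Gfree; rewrite -row_free_unit -kermx_eq0; apply/eqP/row_matrixP => i.
rewrite row0; set u := row i _.
have uGG : u *m (G *m G^T) = 0 by rewrite -row_mul mulmx_ker row0.
suff uG0 : u *m G = 0.
  by apply: (row_free_inj Gfree); rewrite uG0 mul0mx.
have /matrixP/(_ 0 0) : (u *m G) *m (u *m G)^T = 0.
  by rewrite trmx_mul !mulmxA -(mulmxA u) uGG mul0mx.
rewrite !mxE => /eqP; rewrite psumr_eq0; last first.
  by move=> j _; rewrite [X in _ * X]mxE -expr2 sqr_ge0.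
move=> /allP s0; apply/matrixP => a j; rewrite (ord1 a).
have := s0 j (mem_index_enum j).
by rewrite /= [X in _ * X]mxE -expr2 sqrf_eq0 => /eqP ->; rewrite mxE.
Qed.

Lemma moore_penrose_fact n m p (F : 'M[R]_(n, p)) (G : 'M[R]_(p, m)) :
    F^T *m F \in unitmx -> G *m G^T \in unitmx ->
  moore_penrose (F *m G)
    (G^T *m invmx (G *m G^T) *m invmx (F^T *m F) *m F^T).
Proof.
move=> FU GU; set X := G^T *m _ *m _ *m _.
have CX : F *m G *m X = F *m invmx (F^T *m F) *m F^T.
  rewrite /X !mulmxA -(mulmxA F G) -(mulmxA F _ (invmx _)).
  by rewrite mulmxV // mulmx1.
have XC : X *m (F *m G) = G^T *m invmx (G *m G^T) *m G.
  rewrite /X !mulmxA -(mulmxA _ F^T F) -(mulmxA _ (invmx (F^T *m F))).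
  by rewrite mulVmx // mulmx1.
split.
- rewrite CX !mulmxA -(mulmxA _ F^T F) -(mulmxA F _ (F^T *m F)).
  by rewrite mulVmx // mulmx1.
- rewrite XC /X !mulmxA -(mulmxA _ G G^T) -(mulmxA G^T _ (G *m G^T)).
  by rewrite mulVmx // mulmx1.
- by rewrite CX !trmx_mul trmx_inv trmx_mul !trmxK mulmxA.
- by rewrite XC !trmx_mul trmx_inv trmx_mul !trmxK mulmxA.
Qed.

Lemma moore_penrose_ex n m (C : 'M[R]_(n, m)) : exists X, moore_penrose C X.
Proof.
have FU : (col_base C)^T *m col_base C \in unitmx.
  rewrite -{2}(trmxK (col_base C)); apply: gram_unit.
  by rewrite /row_free mxrank_tr; exact: col_base_full.
have GU := gram_unit (row_base_free C).
by have := moore_penrose_fact FU GU; rewrite mulmx_base => CX; eexists; exact: CX.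
Qed.

Lemma mpinvP n m (C : 'M[R]_(n, m)) : moore_penrose C (mpinv C).
Proof. by have [X CX] := moore_penrose_ex C; exact: (xgetPex 0 (ex_intro _ X CX)). Qed.

Lemma mpinv_unique n m (C : 'M[R]_(n, m)) (X : 'M[R]_(m, n)) :
  moore_penrose C X -> X = mpinv C.
Proof.
have [] := mpinvP C; move: (mpinv C) => Y y1 y2 y3 y4 [x1 x2 x3 x4].
have e1 : C *m X = C *m Y.
  rewrite -x3 -{1}y1 -mulmxA trmx_mul x3 y3.
  by rewrite mulmxA x1.
have e2 : X *m C = Y *m C.
  rewrite -x4 -{1}y1 !mulmxA -(mulmxA (X *m C)) trmx_mul x4 y4.
  by rewrite -mulmxA (mulmxA C) x1.
by rewrite -x2 e2 -mulmxA e1 mulmxA y2.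
Qed.

End LinearAlgebra.

Section Probability.
Context {R : realType}.

(* The sigma-algebra SA of the target is explicit because a measurableType
   must be pointed, which excludes 'I_n. *)
Definition mutually_independent d (T : measurableType d) (P : probability T R)
    (S : Type) (SA : set (set S)) (I : finType) (X : I -> T -> S) : Prop :=
  forall (J : {set I}) (B : I -> set S),
    (forall i, i \in J -> SA (B i)) ->
    P (\bigcap_(i in [set` J]) (X i @^-1` B i)) =
    (\prod_(i in J) P (X i @^-1` B i))%E.

Definition iid d (T : measurableType d) (P : probability T R)
    (S : Type) (SA : set (set S)) (law : set S -> \bar R)
    (I : finType) (X : I -> T -> S) : Prop :=
  [/\ forall i B, SA B -> measurable (X i @^-1` B),
      mutually_independent P SA X
    & forall i B, SA B -> P (X i @^-1` B) = law B].

Definition sign_law (B : set R) : \bar R :=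
  ((2^-1)%:E * \d_(1%R : R) B + (2^-1)%:E * \d_((-1)%R : R) B)%E.

Definition index_law n (p : 'I_n -> R) (B : set 'I_n) : \bar R :=
  (\sum_(i < n | i \in B) p i)%:E.

(* The t x n matrix with i.i.d. entries X (i, j), rescaled by 1/sqrt t. *)
Definition rescaled_matrix (T : Type) t n (X : 'I_t * 'I_n -> T -> R) (w : T) :
  'M[R]_(t, n) := (Num.sqrt t%:R)^-1 *: \matrix_(i < t, j < n) X (i, j) w.

(* The event S is not required to be measurable: S has probability at least a
   for the completion of P. *)
Definition prob_ge d (T : measurableType d) (P : probability T R) (S : set T)
    (a : R) : Prop :=
  exists E : set T, [/\ measurable E, E `<=` S & (a%:E <= P E)%E].

End Probability.

(* Main.v *)
From HB Require Import structures.
Require Import Defs.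
From mathcomp Require Import all_boot all_order all_algebra.
From mathcomp Require Import all_classical all_reals all_analysis.
From mathcomp Require Import measurable_realfun ring lra.
Import Order.TTheory GRing.Theory Num.Theory.
Import numFieldNormedType.Exports.
Local Open Scope classical_set_scope.
Local Open Scope ring_scope.

(* If [R A y = 0] forces [A y = 0], the row space of [R A] is that of [A], so
   [P_{RA}(A) = A] and there is no loss at all; this happens as soon as [R U]
   has rank [r].  For signs and for leverage-score sampling one exposes the rows
   of [R U] one at a time: a sign row leaves a given proper subspace with
   probability at least [1/2], a leverage row leaves a subspace of codimension
   [d] with probability at least [d / r], so [2 ^ d - 1], respectively [d],
   contracts in mean by [3/4], respectively [1 - 1/r].

   For Gaussian [R] with [t] at least of order [r], [R U] is a near-isometry,
   hence injective.  For smaller [t], let [R A y = 0] and split [a = S V^T y]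
   as [a1 + a2] along the first [k] coordinates.  Then [R U a1 = - R U a2],
   where [R U] is a near-isometry on the first [k] coordinates and has norm of
   order [sqrt (r / t)] overall, so [|A y| <= |a1| + |a2|] is at most
   [1 + O(sqrt (r / t))] times [s_{k+1} |y|], and [s_{k+1} <= |A - A_k|] by
   Eckart-Young.  The near-isometries come from the exact moment generating
   function of a chi-square and a union bound over a lattice net. *)

Set Implicit Arguments.
Unset Strict Implicit.
Unset Printing Implicit Defensive.

(** * Squared norms and a lattice net of the unit ball *)

Section SquaredNorm.
Context {R : realType}.

Definition sqn n (x : 'cV[R]_n) : R := \sum_i x i 0 ^+ 2.

Definition dotp n (x y : 'cV[R]_n) : R := \sum_i x i 0 * y i 0.

Lemma dotpp n (x : 'cV[R]_n) : dotp x x = sqn x.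
Proof. by apply: eq_bigr => i _; rewrite expr2. Qed.

Lemma sqn_ge0 n (x : 'cV[R]_n) : 0 <= sqn x.
Proof. by apply: sumr_ge0 => i _; exact: sqr_ge0. Qed.

Lemma sqn_eq0 n (x : 'cV[R]_n) : sqn x = 0 -> x = 0.
Proof.
move/eqP; rewrite psumr_eq0 => [/allP x0|i _]; last exact: sqr_ge0.
apply/matrixP => i j; rewrite (ord1 j) mxE; apply/eqP.
by have := x0 i (mem_index_enum i); rewrite /= sqrf_eq0.
Qed.

Lemma sqn0 n : sqn (0 : 'cV[R]_n) = 0.
Proof. by apply: big1 => i _; rewrite mxE expr0n. Qed.

Lemma sqnZ n a (x : 'cV[R]_n) : sqn (a *: x) = a ^+ 2 * sqn x.
Proof. by rewrite mulr_sumr; apply: eq_bigr => i _; rewrite mxE exprMn. Qed.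

Lemma sqnN n (x : 'cV[R]_n) : sqn (- x) = sqn x.
Proof. by rewrite -scaleN1r sqnZ sqrrN expr1n mul1r. Qed.

Lemma sqnD n (x y : 'cV[R]_n) : sqn (x + y) = sqn x + sqn y + 2 * dotp x y.
Proof.
rewrite mulr_sumr -!big_split; apply: eq_bigr => i _ /=.
by rewrite mxE sqrrD -mulr_natl; ring.
Qed.

Lemma sqnB n (x y : 'cV[R]_n) : sqn (x - y) = sqn x + sqn y - 2 * dotp x y.
Proof.
rewrite sqnD sqnN; congr (_ + _); rewrite -mulrN; congr (_ * _).
by rewrite -sumrN; apply: eq_bigr => i _; rewrite mxE mulrN.
Qed.

Lemma dotp_mx n (x y : 'cV[R]_n) : dotp x y = (x^T *m y) 0 0.
Proof. by rewrite mxE; apply: eq_bigr => i _; rewrite mxE. Qed.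

Lemma dotpZr n a (x y : 'cV[R]_n) : dotp x (a *: y) = a * dotp x y.
Proof. by rewrite mulr_sumr; apply: eq_bigr => i _; rewrite mxE mulrCA. Qed.

(** With [p = x - y] and [q = x + y], both sides equal [4 * dotp p q]. The weights 3 and 1/3 balance
    a short difference against a long sum: in the net argument [|p| <= 1/4] and [|q| <= 2]. *)
Lemma sqn_polarization n (x y : 'cV[R]_n) :
  4 * (sqn x - sqn y) =
  sqn (3 *: (x - y) + 3^-1 *: (x + y)) - sqn (3 *: (x - y) - 3^-1 *: (x + y)).
Proof.
rewrite -!sumrB mulr_sumr; apply: eq_bigr => i _; rewrite !mxE.
by field.
Qed.

Lemma cauchy_schwarz_dotp n (x y : 'cV[R]_n) :
  dotp x y ^+ 2 <= sqn x * sqn y.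
Proof.
have [y0|y0] := eqVneq (sqn y) 0.
  rewrite (sqn_eq0 y0) sqn0 mulr0 /dotp big1 ?expr0n// => i _.
  by rewrite mxE mulr0.
have y_gt0 : 0 < sqn y by rewrite lt_neqAle eq_sym y0 sqn_ge0.
have := sqn_ge0 (x - (dotp x y / sqn y) *: y).
rewrite sqnB sqnZ dotpZr.
have -> : sqn x + (dotp x y / sqn y) ^+ 2 * sqn y -
  2 * (dotp x y / sqn y * dotp x y) = sqn x - dotp x y ^+ 2 / sqn y by field.
by rewrite subr_ge0 ler_pdivrMr.
Qed.

Lemma l2norm_sqn n (x : 'cV[R]_n) : l2norm x = Num.sqrt (sqn x).
Proof. by congr Num.sqrt; apply: eq_bigr => i _; rewrite big_ord1. Qed.

Lemma l2norm_sqr n (x : 'cV[R]_n) : l2norm x ^+ 2 = sqn x.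
Proof. by rewrite l2norm_sqn sqr_sqrtr// sqn_ge0. Qed.

Lemma l2norm_ge0 n (x : 'cV[R]_n) : 0 <= l2norm x.
Proof. exact: sqrtr_ge0. Qed.

Lemma l2norm_sqr_le n (x : 'cV[R]_n) a : 0 <= a -> sqn x <= a ^+ 2 -> l2norm x <= a.
Proof.
by move=> a0 xa; rewrite -(ler_pXn2r (n := 2))// ?nnegrE ?l2norm_ge0// l2norm_sqr.
Qed.

Lemma l2normD n (x y : 'cV[R]_n) : l2norm (x + y) <= l2norm x + l2norm y.
Proof.
apply: l2norm_sqr_le; first by rewrite addr_ge0 ?l2norm_ge0.
have xy : dotp x y <= l2norm x * l2norm y.
  apply: le_trans (ler_norm _) _; rewrite -sqrtr_sqr !l2norm_sqn -sqrtrM ?sqn_ge0//.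
  by rewrite ler_sqrt ?mulr_ge0 ?sqn_ge0// cauchy_schwarz_dotp.
by rewrite sqnD sqrrD !l2norm_sqr; lra.
Qed.

Lemma l2normZ n a (x : 'cV[R]_n) : l2norm (a *: x) = `|a| * l2norm x.
Proof. by rewrite !l2norm_sqn sqnZ sqrtrM ?sqr_ge0// sqrtr_sqr. Qed.

Lemma sqn_isometry n r (U : 'M[R]_(n, r)) (x : 'cV[R]_r) :
  U^T *m U = 1%:M -> sqn (U *m x) = sqn x.
Proof.
by move=> UU; rewrite -!dotpp !dotp_mx trmx_mul -mulmxA (mulmxA U^T) UU mul1mx.
Qed.

Lemma l2norm_isometry n r (U : 'M[R]_(n, r)) (x : 'cV[R]_r) :
  U^T *m U = 1%:M -> l2norm (U *m x) = l2norm x.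
Proof. by move=> UU; rewrite !l2norm_sqn sqn_isometry. Qed.

Definition frobenius_sqr m n (A : 'M[R]_(m, n)) : R := \sum_i \sum_j A i j ^+ 2.

Lemma sqn_mulmx_le m n (A : 'M[R]_(m, n)) (x : 'cV[R]_n) :
  sqn (A *m x) <= frobenius_sqr A * sqn x.
Proof.
rewrite mulr_suml; apply: ler_sum => i _; rewrite mxE.
have := cauchy_schwarz_dotp (row i A)^T x.
congr (_ <= _); first by congr (_ ^+ 2); apply: eq_bigr => j _; rewrite !mxE.
by congr (_ * _); apply: eq_bigr => j _; rewrite !mxE.
Qed.

(** The Frobenius norm is the bound, so the [sup] in [spectral_norm] is a genuine supremum. *)
Lemma has_ubound_spectral m n (A : 'M[R]_(m, n)) :
  has_ubound [set l2norm (A *m x) | x in [set x : 'cV[R]_n | l2norm x <= 1]].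
Proof.
exists (Num.sqrt (frobenius_sqr A)) => _ [y /= y1 <-].
rewrite l2norm_sqn ler_wsqrtr// (le_trans (sqn_mulmx_le _ _))// ler_piMr//.
  by apply: sumr_ge0 => i _; apply: sumr_ge0 => j _; exact: sqr_ge0.
by rewrite -l2norm_sqr expr_le1// l2norm_ge0.
Qed.

Lemma l2norm_spectral m n (A : 'M[R]_(m, n)) (x : 'cV[R]_n) :
  l2norm (A *m x) <= spectral_norm A * l2norm x.
Proof.
have [x0|x0] := eqVneq (sqn x) 0.
  by rewrite (sqn_eq0 x0) mulmx0 !l2norm_sqn !sqn0 sqrtr0 mulr0.
have lx0 : 0 < l2norm x.
  by rewrite l2norm_sqn sqrtr_gt0 lt_neqAle eq_sym x0 sqn_ge0.
rewrite -ler_pdivrMr//; apply: (ub_le_sup (has_ubound_spectral A)).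
exists ((l2norm x)^-1 *: x).
  by rewrite /= l2normZ gtr0_norm ?invr_gt0// mulVf// gt_eqF.
by rewrite -scalemxAr l2normZ gtr0_norm ?invr_gt0// mulrC.
Qed.

Lemma spectral_norm_le m n (A : 'M[R]_(m, n)) (a : R) :
  (forall x : 'cV[R]_n, l2norm (A *m x) <= a * l2norm x) -> 0 <= a ->
  spectral_norm A <= a.
Proof.
move=> Aa a0; apply: ge_sup.
  by exists (l2norm (A *m (0 : 'cV[R]_n))), 0 => //=; rewrite l2norm_sqn sqn0 sqrtr0.
by move=> _ [x /= x1 <-]; rewrite (le_trans (Aa x))// ler_piMr.
Qed.

Lemma spectral_norm_ge0 m n (A : 'M[R]_(m, n)) : 0 <= spectral_norm A.
Proof.
have ubA := has_ubound_spectral A.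
by apply: (ub_le_sup ubA); exists 0; rewrite /= ?mulmx0 l2norm_sqn sqn0 sqrtr0.
Qed.

End SquaredNorm.

(** Integer vectors, coded by absolute value and sign in each coordinate. The cap [16 * d] loses no
    point of the ball, where each squared coordinate is at most [16 * d]. *)
Local Notation grid d := {ffun 'I_d -> 'I_(16 * d).+1 * bool}.

Section Net.
Context {R : realType} (d : nat).

Definition grid_point (z : grid d) : 'cV[R]_d :=
  \col_i ((-1) ^+ (z i).2 * (z i).1%:R / (4 * Num.sqrt d%:R)).

(** The mesh is [1 / (4 sqrt d)], so for [d > 0] this says that [grid_point z] lies in the unit
    ball. *)
Definition in_ball (z : grid d) : bool :=
  (\sum_i (z i).1 ^ 2 <= 16 * d)%N.

Lemma sqn_grid_point (z : grid d) : in_ball z -> sqn (grid_point z) <= 1.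
Proof.
move=> zb; have [d0|d0] := posnP d.
  rewrite /sqn big1 ?ler01// => i _.
  by have := ltn_ord i; rewrite {2}d0.
have -> : sqn (grid_point z) = (\sum_i (z i).1 ^ 2)%:R / (16 * d)%:R :> R.
  rewrite natr_sum mulr_suml; apply: eq_bigr => i _; rewrite mxE.
  rewrite expr_div_n exprMn sqrr_sign mul1r natrX exprMn sqr_sqrtr//.
  by rewrite natrM; congr (_ / (_ * _)); rewrite -natrX.
by rewrite ler_pdivrMr ?mul1r ?ler_nat// ltr0n muln_gt0.
Qed.

(** Each coordinate is rounded towards 0, which keeps the point in the ball and moves each of the
    [d] coordinates by at most [1 / (4 sqrt d)]. *)
Lemma grid_approx (x : 'cV[R]_d) : sqn x <= 1 ->
  exists2 z, in_ball z & sqn (x - grid_point z) <= 1 / 16.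
Proof.
move=> x1.
have [d0|d0] := posnP d.
  exists [ffun=> (ord0, false)].
    by rewrite /in_ball big1// => i _; rewrite ffunE.
  by rewrite /sqn big1// => i; have := ltn_ord i; rewrite {2}d0.
pose h : R := 4 * Num.sqrt d%:R.
have h0 : 0 < h by rewrite mulr_gt0// sqrtr_gt0 ltr0n.
have h2 : h ^+ 2 = (16 * d)%:R.
  by rewrite exprMn sqr_sqrtr// natrM; congr (_ * _); rewrite -natrX.
pose k i := Num.truncn (h * `|x i 0|).
have hx0 i : 0 <= h * `|x i 0| by rewrite mulr_ge0// ltW.
have kx i : (k i)%:R <= h * `|x i 0| by rewrite truncn_le.
have xk i : h * `|x i 0| < (k i).+1%:R by apply: truncnS_gt.
have sumk : (\sum_i k i ^ 2 <= 16 * d)%N.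
  rewrite -(ler_nat R) natr_sum -h2.
  apply: (@le_trans _ _ (h ^+ 2 * sqn x)); last by rewrite ler_piMr// sqr_ge0.
  rewrite mulr_sumr; apply: ler_sum => i _.
  by rewrite natrX -[x i 0 ^+ 2]real_normK ?num_real// -exprMn lerXn2r ?nnegrE.
have kN i : (k i < (16 * d).+1)%N.
  rewrite ltnS (leq_trans _ sumk)// (bigD1 i)//=.
  by rewrite (leq_trans _ (leq_addr _ _))//; case: (k i) => // a; rewrite leq_pmull.
exists [ffun i => (Ordinal (kN i), x i 0 < 0)].
  by rewrite /in_ball; under eq_bigr do rewrite ffunE.
apply: (@le_trans _ _ (\sum_(i < d) (h ^+ 2)^-1)).
  apply: ler_sum => i _; rewrite !mxE ffunE /= -/h.
  set b := x i 0 < 0.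
  have -> : x i 0 = (-1) ^+ b * `|x i 0|.
    exact: numEsign.
  rewrite -mulrA -mulrBr exprMn sqrr_sign mul1r -exprVn.
  have -> : `|x i 0| - (k i)%:R / h = (h * `|x i 0| - (k i)%:R) / h.
    by rewrite mulrBl mulrAC divff ?mul1r// gt_eqF.
  rewrite exprMn ler_piMl ?sqr_ge0// expr_le1// ?subr_ge0//.
  by rewrite lerBlDl natr1 ltW.
rewrite sumr_const card_ord h2 -[_ *+ d]mulr_natr natrM.
have dR : d%:R != 0 :> R by rewrite pnatr_eq0 -lt0n.
by rewrite le_eqVlt; apply/orP; left; apply/eqP; field.
Qed.

(* Weighting [z] by [2 ^ (- sum_i |z_i|)] turns the count into a product of
   geometric sums. *)
Lemma card_in_ball : (#|in_ball| <= 2 ^ (18 * d))%N.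
Proof.
rewrite -(ler_nat R) -sum1_card natr_sum.
pose wt (p : 'I_(16 * d).+1 * bool) : R := 2^-1 ^+ p.1.
apply: (@le_trans _ _ (\sum_(z : grid d)
      (2 ^ (16 * d))%:R * \prod_i wt (z i))).
  rewrite [leRHS](bigID in_ball)/= ler_wpDr//.
    apply: sumr_ge0 => z _; rewrite mulr_ge0// prodr_ge0// => i _.
    by rewrite exprn_ge0.
  apply: ler_sum => z zb; rewrite prodrXr natrX exprVn.
  rewrite ler_pdivlMr ?exprn_gt0// mul1r ler_eXn2l ?ltr1n//.
  apply: leq_trans zb; apply: leq_sum => i _.
  by case: (nat_of_ord _) => // k; rewrite leq_pmull.
rewrite -mulr_sumr -(bigA_distr_bigA (fun _ => wt)).
rewrite (_ : (18 * d = 16 * d + 2 * d)%N); last by rewrite -mulnDl.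
rewrite expnD natrM ler_pM2l ?ltr0n ?expn_gt0//.
rewrite prodr_const card_ord expnM natrX lerXn2r ?nnegrE//.
  by apply: sumr_ge0 => p _; rewrite exprn_ge0.
(* Each coordinate contributes a geometric sum below 2, doubled by the sign: a factor at most 4,
   hence the [2 * d] in the exponent. *)
have geo m : \sum_(k < m) 2^-1 ^+ k = 2 - 2 * 2^-1 ^+ m :> R.
  elim: m => [|m IHm]; first by rewrite big_ord0 expr0; lra.
  by rewrite big_ord_recr /= IHm exprS; field.
rewrite -(pair_bigA _ (fun (k : 'I_(16 * d).+1) (b : bool) => 2^-1 ^+ k : R))/=.
rewrite exchange_big big_bool /= geo natrX.
have : 0 <= 2^-1 ^+ (16 * d).+1 :> R by rewrite exprn_ge0.
by move: (2^-1 ^+ _) => e; lra.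
Qed.

(** Let [M] be the supremum of [|q|] on the unit ball, finite by the bound with [C]. Moving from a
    point to its net neighbour changes [q] by at most [145 / 288 * M], so
    [M <= tau + 145 / 288 * M], whence [M <= 3 * tau]. *)
Lemma quadratic_form_net (q : 'cV[R]_d -> R) (C tau : R) :
    (forall a x, q (a *: x) = a ^+ 2 * q x) ->
    (forall x y, 4 * (q x - q y) =
       q (3 *: (x - y) + 3^-1 *: (x + y)) - q (3 *: (x - y) - 3^-1 *: (x + y))) ->
    (forall x, `|q x| <= C * sqn x) ->
    (forall z, in_ball z -> `|q (grid_point z)| <= tau) ->
  forall x, `|q x| <= 3 * tau * sqn x.
Proof.
move=> qZ qP qC qtau.
pose B := [set `|q x| | x in [set x : 'cV[R]_d | sqn x <= 1]].
have q0 : q 0 = 0 by have := qZ 0 0; rewrite scale0r expr0n mul0r.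
have ubB : has_ubound B.
  exists `|C| => _ [x /= x1 <-]; rewrite (le_trans (qC x))//.
  rewrite (@le_trans _ _ (`|C| * sqn x))// ?ler_wpM2r ?sqn_ge0 ?ler_norm//.
  by rewrite ler_piMr.
have qs x : `|q x| <= sup B * sqn x.
  have [x0|x0] := eqVneq (sqn x) 0.
    by rewrite (sqn_eq0 x0) q0 sqn0 mulr0 normr0.
  have x_gt0 : 0 < sqn x by rewrite lt_neqAle eq_sym x0 sqn_ge0.
  rewrite -ler_pdivrMr//; apply: (ub_le_sup ubB).
  have sx : (Num.sqrt (sqn x))^-1 ^+ 2 = (sqn x)^-1.
    by rewrite exprVn sqr_sqrtr ?sqn_ge0.
  exists ((Num.sqrt (sqn x))^-1 *: x); first by rewrite /= sqnZ sx mulVf.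
  by rewrite qZ sx normrM ger0_norm ?invr_ge0 ?sqn_ge0// mulrC.
suff sB : sup B <= 3 * tau.
  by move=> x; rewrite (le_trans (qs x))// ler_wpM2r// sqn_ge0.
have tau0 : 0 <= tau.
  have [z /qtau qz _] := @grid_approx 0 (eq_ind_r (fun c : R => c <= 1) ler01 (sqn0 d)).
  exact: le_trans qz.
suff : sup B <= tau + 145 / 288 * sup B by move=> ?; lra.
apply: ge_sup; first by exists `|q 0|, 0; rewrite //= sqn0.
move=> _ [x /= x1 <-].
have [z zb xz] := grid_approx x1.
set y := grid_point z in xz *.
have y1 : sqn y <= 1 by exact: sqn_grid_point.
have s0 : 0 <= sup B.
  by apply: (ub_le_sup ubB); exists 0; rewrite /= ?sqn0// q0 normr0.
(* By the parallelogram law the two polarized vectors have squared norms summing to at most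
   [2 * (9 / 16 + 4 / 9)]; dividing by 4 gives [145 / 288]. *)
have qxy : `|q x - q y| <= 145 / 288 * sup B.
  have xy4 : sqn (x + y) <= 4.
    have := sqn_ge0 (x - y); rewrite sqnB sqnD => xy0. lra.
  have := qs (3 *: (x - y) + 3^-1 *: (x + y)).
  have := qs (3 *: (x - y) - 3^-1 *: (x + y)).
  rewrite sqnB sqnD !sqnZ => q2 q1.
  set D := dotp _ _ in q1 q2.
  have : `|4 * (q x - q y)| <=
      sup B * (2 * (3 ^+ 2 * sqn (x - y) + 3^-1 ^+ 2 * sqn (x + y))).
    rewrite qP (le_trans (ler_normB _ _))// (le_trans (lerD q1 q2))//.
    rewrite -mulrDr ler_wpM2l//. lra.
  rewrite normrM ger0_norm// => q4.
  have : sup B * (2 * (3 ^+ 2 * sqn (x - y) + 3^-1 ^+ 2 * sqn (x + y))) <=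
     sup B * (2 * (9 / 16 + 4 / 9)).
    by rewrite ler_wpM2l//; lra.
  by move: q4; set e := sup B * _ => q4; lra.
have := qtau z zb; rewrite -/y => qy.
by have := ler_normD (q x - q y) (q y); rewrite subrK => ?; lra.
Qed.

End Net.

(** * Integrating against the normal law *)

Section NormalIntegral.
Context {R : realType}.
Local Notation mu := (@lebesgue_measure R).
Import HBNNSimple.

Lemma integral_normal_prob_indic (m s : R) (E : set R) : measurable E ->
  (\int[normal_prob m s]_x (\1_E x)%:E =
   \int[mu]_x ((\1_E x)%:E * (normal_pdf m s x)%:E))%E.
Proof.
move=> mE; rewrite integral_indic//= setIT /normal_prob.
rewrite [LHS]integral_mkcond; apply: eq_integral => x _.
rewrite patchE indicE; case: ifPn => _; first by rewrite mul1e.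
by rewrite mul0e.
Qed.

Lemma integral_normal_prob_nnsfun (m s : R) (f : {nnsfun R >-> R}) :
  (\int[normal_prob m s]_x (f x)%:E =
   \int[mu]_x ((f x)%:E * (normal_pdf m s x)%:E))%E.
Proof.
have mpdf : measurable_fun [set: R] (fun x => (normal_pdf m s x)%:E : \bar R).
  by apply/measurable_EFinP; exact: measurable_normal_pdf.
have mind r : measurable_fun [set: R] (fun x => (\1_(f @^-1` [set r]) x)%:E : \bar R).
  by apply/measurable_EFinP; exact: measurable_indic.
under [LHS]eq_integral do rewrite fimfunE -fsumEFin//.
rewrite [LHS]ge0_integral_fsum//; last 2 first.
- move=> r; apply/measurable_EFinP; apply: measurable_funM; first exact: measurable_cst.
  exact: ((measurable_EFinP _ _).1 (mind r)).
- by move=> n x _; rewrite EFinM nnfun_muleindic_ge0.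
under [RHS]eq_integral.
  move=> x _; rewrite fimfunE -fsumEFin// ge0_mule_fsuml; last first.
    by move=> r; rewrite EFinM nnfun_muleindic_ge0.
  over.
rewrite [RHS]ge0_integral_fsum//; last 2 first.
- move=> r; apply: emeasurable_funM => //; apply/measurable_EFinP.
  apply: measurable_funM; first exact: measurable_cst.
  exact: ((measurable_EFinP _ _).1 (mind r)).
- move=> r x _; apply: mule_ge0; last by rewrite lee_fin normal_pdf_ge0.
  by rewrite EFinM nnfun_muleindic_ge0.
apply: eq_fsbigr => r /[!inE] -[x _ fxr].
have r0 : (0 <= r%:E)%E by rewrite -fxr lee_fin.
under eq_integral do rewrite EFinM.
rewrite ge0_integralZl//; last exact: mind.
rewrite integral_normal_prob_indic// -ge0_integralZl//.
- by apply: eq_integral => y _; rewrite EFinM muleA.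
- by apply: emeasurable_funM; [exact: mind|].
- by move=> y _; rewrite mule_ge0// lee_fin normal_pdf_ge0.
Qed.

(** Both sides are monotone limits along the same simple functions [f_], for which the formula
    reduces to indicators. *)
Lemma ge0_integral_normal_prob (m s : R) (f : R -> \bar R) :
  measurable_fun setT f -> (forall x, 0 <= f x)%E ->
  (\int[normal_prob m s]_x f x =
   \int[mu]_x (f x * (normal_pdf m s x)%:E))%E.
Proof.
move=> mf f0.
have mpdf : measurable_fun [set: R] (fun x => (normal_pdf m s x)%:E : \bar R).
  by apply/measurable_EFinP; exact: measurable_normal_pdf.
pose f_ := nnsfun_approx measurableT mf.
have mf_ n : measurable_fun [set: R] (f_ n) by exact: measurable_funPT.
have nd_f x a b : (a <= b)%N -> f_ a x <= f_ b x.
  by move=> ab; have /lefP := nd_nnsfun_approx measurableT mf ab; exact.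
transitivity (lim (\int[normal_prob m s]_x (f_ n x)%:E @[n --> \oo])%E).
  rewrite -monotone_convergence//=.
  - apply: eq_integral => ? /[!inE] xD; apply/esym/cvg_lim => //=.
    exact: cvg_nnsfun_approx.
  - by move=> n; apply/measurable_EFinP; exact: mf_.
  - by move=> n ? _; rewrite lee_fin.
  - by move=> ? _ ? ? mn; rewrite lee_fin; exact: nd_f.
under eq_fun do rewrite integral_normal_prob_nnsfun.

rewrite -monotone_convergence//=.
- apply: eq_integral => x _; apply/cvg_lim => //=.
  apply: cvgeZr => //; exact: cvg_nnsfun_approx.
- by move=> n; apply: emeasurable_funM => //; apply/measurable_EFinP; exact: mf_.
- by move=> n x _; rewrite mule_ge0// lee_fin// normal_pdf_ge0.
- move=> x _ a b ab; rewrite lee_wpmul2r// ?lee_fin ?normal_pdf_ge0//.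
  exact: nd_f.
Qed.

(* The case where the completed square is again a normal density, of variance
   1 / (1 - 2 a u^2) *)
Lemma integral_normal_prob_expR_sqr (a z u : R) : 0 < 1 - 2 * a * u ^+ 2 ->
  (\int[normal_prob 0 1]_x (expR (a * (z + u * x) ^+ 2))%:E =
   ((Num.sqrt (1 - 2 * a * u ^+ 2))^-1 *
     expR (a / (1 - 2 * a * u ^+ 2) * z ^+ 2))%:E)%E.
Proof.
set q := 1 - 2 * a * u ^+ 2 => q0.
rewrite ge0_integral_normal_prob; last 2 first.
- apply/measurable_EFinP/measurableT_comp => //; apply: measurable_funM => //.
  by apply: measurable_funX; apply: measurable_funD => //; exact: measurable_funM.
- by move=> x; rewrite lee_fin expR_ge0.
pose s := (Num.sqrt q)^-1; have s0 : s != 0 by rewrite gt_eqF// invr_gt0 sqrtr_gt0.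
have s2 : s ^+ 2 = q^-1 by rewrite exprVn sqr_sqrtr// ltW.
(* Completing the square: [a (z + u x)^2 - x^2 / 2 = a z^2 / q - q (x - 2 a z u / q)^2 / 2]. *)
transitivity (\int[mu]_x (((Num.sqrt q)^-1 * expR (a / q * z ^+ 2))%:E *
    (normal_pdf (2 * a * z * u / q) s x)%:E))%E.
  apply: eq_integral => x _; rewrite -!EFinM; congr EFin.
  rewrite !normal_pdfE ?oner_neq0// /normal_peak /normal_fun expr1n s2.
  have -> : q^-1 * pi *+ 2 = q^-1 * (1 * pi *+ 2) by ring.
  rewrite [in RHS]sqrtrM ?invr_ge0 ?(ltW q0)// sqrtrV ?(ltW q0)//.
  rewrite invfM invrK mulrCA -expRD.
  rewrite [RHS](_ : _ = (Num.sqrt (1 * pi *+ 2))^-1 *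
      (expR (a / q * z ^+ 2) *
       expR (- (x - 2 * a * z * u / q) ^+ 2 / (q^-1 *+ 2)))); last first.
    move: (expR _) (expR _) => E1 E2.
    have sq : Num.sqrt q != 0 by rewrite gt_eqF// sqrtr_gt0.
    have sp : Num.sqrt (1 * pi *+ 2) != 0 :> R.
      by rewrite gt_eqF// sqrtr_gt0 mul1r mulrn_wgt0// pi_gt0.
    move: (Num.sqrt q) (Num.sqrt (1 * pi *+ 2)) sq sp => x1 x2 sq sp.
    by field; rewrite sp sq.
  rewrite -expRD; congr (_ * expR _); rewrite subr0.
  have q0' : q != 0 by rewrite gt_eqF.
  have -> : q^-1 *+ 2 = 2 / q by ring.
  move: q0'; rewrite /q => q0'; field; exact: q0'.
rewrite /= ge0_integralZl//=.
- by rewrite integral_normal_pdf mule1.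
- by apply/measurable_EFinP; exact: measurable_normal_pdf.
- by move=> x _; rewrite lee_fin normal_pdf_ge0.
Qed.
End NormalIntegral.

(** * Exposing independent variables one at a time *)

Section Fresh.
Context {R : realType} d (T : measurableType d) (P : probability T R).
Context dE (E : measurableType dE) (nu : probability E R).
Context (I : finType) (X : I -> T -> E).

(* [Y] is independent of the family of the [X i] with [i] outside [J] *)
Definition fresh (J : {set I}) d' (S : measurableType d') (Y : T -> S) :=
  measurable_fun setT Y /\
  forall (A : set S) (K : {set I}) (B : I -> set E),
    measurable A -> {in J, forall j, j \notin K} -> (forall i, measurable (B i)) ->
    P (Y @^-1` A `&` \bigcap_(i in [set` K]) (X i @^-1` B i)) =
    (P (Y @^-1` A) * P (\bigcap_(i in [set` K]) (X i @^-1` B i)))%E.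

Hypothesis iidX : iid P measurable nu X.

Lemma iid_measurable_fun i : measurable_fun setT (X i).
Proof. by move=> _ B mB; rewrite setTI; case: iidX => /(_ i B mB). Qed.

Lemma measurable_cylinder (K : {set I}) (B : I -> set E) :
  (forall i, measurable (B i)) ->
  measurable (\bigcap_(i in [set` K]) (X i @^-1` B i)).
Proof.
move=> mB; apply: fin_bigcap_measurable => // i _.
by rewrite -[X in measurable X]setTI; exact: iid_measurable_fun.
Qed.

Lemma fresh_cst d' (S : measurableType d') (y : S) : fresh finset.set0 (cst y).
Proof.
split=> [//|A K B _ _ _].
have [yA|yA] := pselect (A y).
  rewrite (_ : _ @^-1` _ = setT) ?setTI ?probability_setT ?mul1e//.
  by apply/seteqP; split.
rewrite (_ : _ @^-1` _ = set0) ?set0I ?measure0 ?mul0e//.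
by apply/seteqP; split.
Qed.

Lemma fresh_comp (J : {set I}) d1 (S1 : measurableType d1) d2
    (S2 : measurableType d2) (Y : T -> S1) (h : S1 -> S2) :
  measurable_fun setT h -> fresh J Y -> fresh J (h \o Y).
Proof.
move=> mh [mY indY]; split; first exact: measurableT_comp.
move=> A K B mA JK mB; rewrite comp_preimage; apply: indY => //.
by rewrite -[X in measurable X]setTI; exact: mh.
Qed.

(** The condition on [X i] is absorbed into the cylinder, now over [i |: K]. Freshness of [Y] splits
    off [A], then mutual independence splits off [B0]. *)
Lemma fresh_rectangle (J : {set I}) d1 (S : measurableType d1) (Y : T -> S)
    (i : I) (A : set S) (B0 : set E) (K : {set I}) (B : I -> set E) :
    fresh J Y -> i \notin J -> {in i |: J, forall j, j \notin K} ->
    measurable A -> measurable B0 -> (forall j, measurable (B j)) ->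
  P ((fun w => (Y w, X i w)) @^-1` (A `*` B0) `&`
     \bigcap_(j in [set` K]) (X j @^-1` B j)) =
  (P (Y @^-1` A) *
   (nu B0 * P (\bigcap_(j in [set` K]) (X j @^-1` B j))))%E.
Proof.
move=> [mY indY] iJ iJK mA mB0 mB.
have iK : i \notin K by apply: iJK; rewrite setU11.
have JK : {in J, forall j, j \notin i |: K}.
  move=> j jJ; rewrite !inE negb_or iJK ?inE ?jJ ?orbT// andbT.
  by apply: contraNneq iJ => <-.
pose B' j := if j == i then B0 else B j.
have mB' j : measurable (B' j) by rewrite /B'; case: ifP.
have B'K j : j \in K -> B' j = B j.
  by move=> jK; rewrite /B' ifN//; apply: contraNneq iK => <-.
have capE : \bigcap_(j in [set` i |: K]) (X j @^-1` B' j) =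
    X i @^-1` B0 `&` \bigcap_(j in [set` K]) (X j @^-1` B j).
  apply/seteqP; split=> w.
    move=> H; split; first by have := H i; rewrite /= setU11 /B' eqxx; exact.
    by move=> j jK; have := H j; rewrite /= inE jK orbT -B'K//; exact.
  move=> [Hi H] j /=; rewrite !inE => /orP[/eqP->|jK]; first by rewrite /B' eqxx.
  by have := H j jK; rewrite /= B'K.
rewrite (_ : _ `&` _ =
    Y @^-1` A `&` \bigcap_(j in [set` i |: K]) (X j @^-1` B' j)); last first.
  rewrite capE setIA; congr (_ `&` _).
rewrite indY//.
congr *%E.
have [_ ind law] := iidX.
rewrite ind//.
rewrite big_setU1//= /B' eqxx law//; congr *%E.
rewrite ind//.
apply: eq_bigr => j jK; rewrite ifN//.
by apply: contraNneq iK => <-.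
Qed.

Section Read.
Context (J : {set I}) d1 (S : measurableType d1) (Y : T -> S) (i : I).
Hypotheses (fY : fresh J Y) (iJ : i \notin J).

Let YX w := (Y w, X i w).

Lemma measurable_fun_read : measurable_fun setT YX.
Proof. by apply: measurable_fun_pair; [case: fY|exact: iid_measurable_fun]. Qed.

HB.instance Definition _ := isMeasurableFun.Build _ _ _ _ Y fY.1.
HB.instance Definition _ := isMeasurableFun.Build _ _ _ _ YX measurable_fun_read.

Lemma law_read (A : set (S * E)) : measurable A ->
  P (YX @^-1` A) = (distribution P Y \x nu)%E A.
Proof.
move=> mA; rewrite -[LHS]/(distribution P YX A); apply/esym.
apply: (product_measure_unique (m' := distribution P YX)) => // A1 A2 mA1 mA2.
have := @fresh_rectangle J _ _ Y i A1 A2 finset.set0 (fun=> setT) fY iJ.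
rewrite (_ : \bigcap_(j in _) _ = setT); last first.
  by apply/seteqP; split => // w _ j; rewrite /= inE.
rewrite setIT probability_setT mule1; apply => //.
by move=> j _; rewrite inE.
Qed.

(** For a fixed cylinder [D] both sides are finite measures of [A]. Each is identified, through its
    values on rectangles, with the product of the law of [Y] and of [nu] scaled by [P D]. *)
Lemma fresh_read : fresh (i |: J) YX.
Proof.
split; first exact: measurable_fun_read.
move=> A K B mA iJK mB.
set D := \bigcap_(_ in _) _.
have mD : measurable D by exact: measurable_cylinder.
pose p := fine (P D); have PD : P D = p%:E by rewrite fineK// fin_num_measure.
have p0 : 0 <= p by rewrite fine_ge0.
pose m1 := distribution P Y.
pose m2 := mscale (NngNum p0) nu.
pose m' := pushforward (mrestr P mD) YX.
have <- : (m1 \x m2)%E A = P (YX @^-1` A `&` D).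
  apply: (product_measure_unique (m' := m')) => // A1 A2 mA1 mA2.
  rewrite /m' /= /pushforward /mrestr (fresh_rectangle fY iJ)//.
  by congr *%E; rewrite PD /m2 /mscale/= muleC.
pose m'' := mscale (NngNum p0) (distribution P YX).
rewrite PD muleC.
apply: (product_measure_unique (m' := m'')) => // A1 A2 mA1 mA2.
rewrite -[LHS]/(p%:E * P (YX @^-1` (A1 `*` A2)))%E.
rewrite law_read; last exact: measurableX.
by rewrite product_measure1E// muleCA.
Qed.

(** Conditioning on the past: [Y] is frozen while the newly read variable is integrated out, by
    Tonelli on the product law. *)
Lemma integral_read (f : S * E -> \bar R) :
  measurable_fun setT f -> (forall z, 0 <= f z)%E ->
  (\int[P]_w f (Y w, X i w) =
   \int[P]_w \int[nu]_x f (Y w, x))%E.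
Proof.
move=> mf f0.
rewrite -[LHS]/(\int[P]_w (f \o YX) w)%E -(ge0_integral_distribution YX)//.
rewrite (eq_measure_integral (distribution P Y \x nu)%E); last first.
  by move=> A mA _; exact: law_read.
rewrite fubini_tonelli1// /fubini_F.
rewrite ge0_integral_distribution//.
- exact: (measurable_fun_fubini_tonelli_F f).
- by move=> y; apply: integral_ge0.
Qed.

End Read.
End Fresh.

(** * The moment generating function of a chi-square *)

Section ChiSquare.
Context {R : realType} d (T : measurableType d) (P : probability T R).

Section Exposure.
Context (I : finType) (X : I -> T -> R).
Hypothesis iidX : iid P measurable (normal_prob 0 1) X.
Local Notation fresh := (fresh P X).

(** Integrating out one normal variable costs a constant factor and replaces the coefficient [a] by
    [a / (1 - 2 a u^2)]; [S] carries what was accumulated earlier. *)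
Lemma integral_expR_read (J : {set I}) (S Z : T -> R) (i : I) (l a u : R) :
    fresh J (fun w => (S w, Z w)) -> i \notin J -> 0 < 1 - 2 * a * u ^+ 2 ->
  (\int[P]_w (expR (l * S w + a * (Z w + u * X i w) ^+ 2))%:E =
   ((Num.sqrt (1 - 2 * a * u ^+ 2))^-1)%:E *
   \int[P]_w (expR (l * S w + a / (1 - 2 * a * u ^+ 2) * Z w ^+ 2))%:E)%E.
Proof.
move=> fSZ iJ q0.
pose f (p : (R * R) * R) : \bar R :=
  (expR (l * p.1.1 + a * (p.1.2 + u * p.2) ^+ 2))%:E.
have mf : measurable_fun setT f.
  apply/measurable_EFinP/measurableT_comp => //.
  apply: measurable_funD.
    by apply: measurable_funM => //; exact: measurableT_comp.
  apply: measurable_funM => //; apply: measurable_funX; apply: measurable_funD.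
    exact: measurableT_comp.
  by apply: measurable_funM.
rewrite -[LHS]/(\int[P]_w f ((S w, Z w), X i w))%E.
rewrite (integral_read iidX fSZ iJ mf); last first.
  by move=> z; rewrite lee_fin expR_ge0.
rewrite -ge0_integralZl//.
- apply: eq_integral => w _; rewrite /f /=.
  under eq_integral do rewrite expRD EFinM.
  rewrite ge0_integralZl//=.
  + by rewrite integral_normal_prob_expR_sqr// expRD -!EFinM mulrCA.
  + apply/measurable_EFinP/measurableT_comp => //; apply: measurable_funM => //.
    by apply: measurable_funX; apply: measurable_funD => //; exact: measurable_funM.
- have [/measurable_fun_pairP[mS mZ] _] := fSZ.
  apply/measurable_EFinP/measurableT_comp => //; apply: measurable_funD.
    exact: measurable_funM.
  by apply: measurable_funM => //; exact: measurable_funX.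
Qed.

Lemma fresh_linear_form (J : {set I}) (S : T -> R) (u : I -> R) (s : seq I) :
    fresh J S -> uniq s -> {in s, forall i, i \notin J} ->
  fresh (J :|: [set i in s]) (fun w => (S w, \sum_(i <- s) u i * X i w)).
Proof.
move=> fS; elim: s => [_ _|i s IHs /= /andP[is0 us] sJ].
  rewrite (_ : J :|: _ = J); last by apply/setP => j; rewrite !inE orbF.
  under eq_fun do rewrite big_nil.
  apply: (fresh_comp (h := fun x : R => (x, 0 : R)) _ fS).
  exact: measurable_fun_pair.
have iJ : i \notin J :|: [set j in s].
  by rewrite !inE negb_or is0 sJ ?mem_head.
have sJ' : {in s, forall j, j \notin J}.
  by move=> j js; apply: sJ; rewrite inE js orbT.
rewrite (_ : J :|: _ = i |: (J :|: [set j in s])); last first.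
  by apply/setP => j; rewrite !inE orbCA.
have := fresh_read iidX (IHs us sJ') iJ.
under [X in _ -> fresh _ X]eq_fun do rewrite big_cons addrC.
apply: (fresh_comp (h := fun p : (R * R) * R => (p.1.1, p.1.2 + u i * p.2))).
apply: measurable_fun_pair; first exact: measurableT_comp.
apply: measurable_funD; first exact: measurableT_comp.
exact: measurable_funM.
Qed.

(** The variables are integrated out one by one, with [a] general in the induction since it changes
    each time. The factors telescope: [q1 * (1 - 2 (a / q1) v) = 1 - 2 a (u_i^2 + v)]. *)
Lemma integral_expR_sqr_linear_form (J : {set I}) (S : T -> R) (u : I -> R)
    (s : seq I) (l a : R) :
    fresh J S -> uniq s -> {in s, forall i, i \notin J} ->
    0 < 1 - 2 * a * \sum_(i <- s) u i ^+ 2 ->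
  (\int[P]_w (expR (l * S w + a * (\sum_(i <- s) u i * X i w) ^+ 2))%:E =
   ((Num.sqrt (1 - 2 * a * \sum_(i <- s) u i ^+ 2))^-1)%:E *
   \int[P]_w (expR (l * S w))%:E)%E.
Proof.
move=> fS; elim: s a => [a _ _ _|i s IHs a /= /andP[is0 us] sJ].
  rewrite big_nil mulr0 subr0 sqrtr1 invr1 mul1e.
  by under eq_integral do rewrite big_nil expr0n/= mulr0 addr0.
rewrite big_cons => q0.
set v := \sum_(j <- s) _ in q0 *.
have v0 : 0 <= v by apply: sumr_ge0 => j _; exact: sqr_ge0.
have iJ : i \notin J :|: [set j in s].
  by rewrite !inE negb_or is0 sJ ?mem_head.
have sJ' : {in s, forall j, j \notin J}.
  by move=> j js; apply: sJ; rewrite inE js orbT.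
set q1 := 1 - 2 * a * u i ^+ 2.
have q1E : 1 - 2 * a * (u i ^+ 2 + v) = q1 - 2 * a * v by rewrite /q1; ring.
have q10 : 0 < q1.
  have u0 := sqr_ge0 (u i).
  have [a0|a0] := ltP a 0; rewrite /q1; first by nra.
  by have := mulr_ge0 a0 v0; lra.
have qE : 1 - 2 * (a / q1) * v = (q1 - 2 * a * v) / q1.
  by field; rewrite gt_eqF.
under eq_integral do rewrite big_cons addrC.
under eq_integral do rewrite [in X in (expR X)]addrC [X in a * X ^+ 2]addrC.
rewrite (integral_expR_read l (fresh_linear_form u fS us sJ') iJ q10).
rewrite IHs// ?qE; last by rewrite divr_gt0// -q1E.
rewrite q1E muleA -EFinM -invfM -sqrtrM ?(ltW q10)//.
by rewrite mulrC divfK ?gt_eqF.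
Qed.

End Exposure.

Context (t n : nat) (X : 'I_t * 'I_n -> T -> R).
Hypothesis iidX : iid P measurable (normal_prob 0 1) X.

Definition row_form (u : 'I_n -> R) (j : 'I_t) (w : T) : R :=
  \sum_(i < n) u i * X (j, i) w.

Lemma row_formE (u : 'I_n -> R) (j : 'I_t) (w : T) :
  row_form u j w =
  \sum_(p <- [seq (j, i) | i <- enum 'I_n]) u p.2 * X p w.
Proof. by rewrite big_map big_enum. Qed.

(** All entries in the rows listed by [js]: what has been read once these rows are exposed. *)
Let rows (js : seq 'I_t) : {set 'I_t * 'I_n} := [set p | p.1 \in js].

Lemma chi_square_exposure (u : 'I_n -> R) (l : R) (js : seq 'I_t) :
    uniq js -> 0 < 1 - 2 * l * \sum_i u i ^+ 2 ->
  fresh P X (rows js) (fun w => \sum_(j <- js) row_form u j w ^+ 2) /\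
  (\int[P]_w (expR (l * \sum_(j <- js) row_form u j w ^+ 2))%:E =
   ((Num.sqrt (1 - 2 * l * \sum_i u i ^+ 2))^-1 ^+ size js)%:E)%E.
Proof.
move=> + q0; elim: js => [_|j js IHjs /= /andP[jjs ujs]].
  split.
    rewrite (_ : rows _ = finset.set0); last by apply/setP => p; rewrite !inE.
    under eq_fun do rewrite big_nil.
    exact: fresh_cst.
  under eq_integral do rewrite big_nil mulr0 expR0.
  by rewrite integral_cst// mul1e; exact: probability_setT.
have [fS IS] := IHjs ujs.
pose cs := [seq (j, i) | i <- enum 'I_n].
have ucs : uniq cs by rewrite map_inj_uniq ?enum_uniq// => x y [].
have csJ : {in cs, forall p, p \notin rows js}.
  by move=> p /mapP[i _ ->]; rewrite inE.
pose u' (p : 'I_t * 'I_n) := u p.2.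
have u'E : \sum_(p <- cs) u' p ^+ 2 = \sum_i u i ^+ 2.
  by rewrite big_map big_enum.
split.
  have := fresh_linear_form iidX u' fS ucs csJ.
  rewrite (_ : rows js :|: _ = rows (j :: js)); last first.
    apply/setP => -[j' i']; rewrite !inE /= orbC; congr (_ || _).
    apply/mapP/eqP => [[i _ []]//|->]; exists i' => //; exact: mem_enum.
  move=> /(fresh_comp (h := fun p : R * R => p.2 ^+ 2 + p.1)).
  rewrite (_ : _ \o _ = (fun w => \sum_(j0 <- j :: js) row_form u j0 w ^+ 2)).
    apply; apply: measurable_funD => //; exact: measurable_funX.
  by apply/funext => w /=; rewrite big_cons row_formE.
under eq_integral do rewrite big_cons row_formE addrC mulrDr.
rewrite (integral_expR_sqr_linear_form iidX l (u := u') fS ucs csJ) u'E//.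
by rewrite IS -EFinM exprS.
Qed.

Lemma chi_square_mgf (u : 'I_n -> R) (l : R) :
    0 < 1 - 2 * l * \sum_i u i ^+ 2 ->
  (\int[P]_w (expR (l * \sum_(j < t) row_form u j w ^+ 2))%:E =
   ((Num.sqrt (1 - 2 * l * \sum_i u i ^+ 2))^-1 ^+ t)%:E)%E.
Proof.
move=> q0; have [_] := chi_square_exposure (enum_uniq 'I_t) q0.
rewrite size_enum_ord => <-.
by under [RHS]eq_integral do rewrite big_enum.
Qed.

Lemma measurable_sum_row_form (u : 'I_n -> R) :
  measurable_fun setT (fun w => \sum_(j < t) row_form u j w ^+ 2).
Proof.
(* At [l = 0] the positivity condition is trivial, and freshness includes measurability. *)
have := @chi_square_exposure u 0 (enum 'I_t) (enum_uniq _).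
rewrite mulr0 mul0r subr0 ltr01 => /(_ isT)[[+ _] _].
by under eq_fun do rewrite big_enum.
Qed.
End ChiSquare.

(** * Gaussian sketches are near-isometries *)

Section Concentration.
Context {R : realType} d (T : measurableType d) (P : probability T R).

Lemma measure_bigsetU_le (I : Type) (s : seq I) (F : I -> set T) :
    (forall i, measurable (F i)) ->
  (P (\big[setU/set0]_(i <- s) F i) <= \sum_(i <- s) P (F i))%E.
Proof.
move=> mF; elim: s => [|i s IHs]; first by rewrite !big_nil measure0.
rewrite !big_cons (le_trans (measureU2 _ _ _))//; first exact: bigsetU_measurable.
exact: leeD.
Qed.

Lemma measurable_superlevel (f : T -> R) (b : R) : measurable_fun setT f ->
  measurable [set w | b <= f w].
Proof.
by move=> mf; rewrite -[X in measurable X]setTI; exact: measurable_fun_le.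
Qed.

Lemma expR_markov (Z : T -> R) (b : R) : measurable_fun setT Z ->
  (P [set w | b <= Z w]%R <= (expR (- b))%:E * \int[P]_w (expR (Z w))%:E)%E.
Proof.
move=> mZ; set E := [set w | _].
have mE : measurable E.
  exact: measurable_superlevel.
have mexp : measurable_fun setT (fun w => (expR (Z w))%:E : \bar R).
  by apply/measurable_EFinP; exact: measurableT_comp.
rewrite -[leLHS]mul1e -[1%E]/(1%R%:E) -(mulVf (lt0r_neq0 (expR_gt0 b))) -expRN.
rewrite EFinM -muleA lee_wpmul2l ?lee_fin ?expR_ge0//.
rewrite -integral_cst//; apply: (@le_trans _ _ (\int[P]_(w in E) (expR (Z w))%:E)%E).
  apply: ge0_le_integral => //.
  - by move=> w _; rewrite lee_fin expR_ge0.
  - exact: measurable_funTS.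
  - by move=> w Ew; rewrite lee_fin ler_expR.
by apply: ge0_subset_integral => // w _; rewrite lee_fin expR_ge0.
Qed.

(** Put [x = l * v]. By [1 + y <= expR y] it suffices that [1 <= (1 - 2 x) (1 + 2 x + 8 l^2)], which
    follows from [x^2 <= l^2] and [1 - 2 x >= 1/2]. *)
Lemma chi_square_mgf_bound (v l : R) (t : nat) : 0 <= v -> v <= 1 ->
    `|l| <= 1 / 4 ->
  (Num.sqrt (1 - 2 * l * v))^-1 ^+ t <= expR (t%:R * (l * v + 4 * l ^+ 2)).
Proof.
move=> v0 v1; rewrite ler_norml => /andP[l1 l2].
rewrite expRM_natl lerXn2r ?nnegrE ?invr_ge0 ?sqrtr_ge0 ?expR_ge0//.
have q0 : 0 < 1 - 2 * l * v by nra.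
rewrite -[leRHS]invrK lef_pV2 ?posrE ?sqrtr_gt0 ?invr_gt0 ?expR_gt0//.
rewrite -expRN -[leLHS]gtr0_norm ?expR_gt0// -sqrtr_sqr ler_sqrt; last exact: ltW.
rewrite -expRM_natl mulrN expRN -[leRHS]invrK lef_pV2 ?posrE ?expR_gt0 ?invr_gt0//.
apply: le_trans (expR_ge1Dx _); rewrite -[leLHS]div1r ler_pdivrMr//.
set x := l * v.
have xl : x ^+ 2 <= l ^+ 2.
  rewrite /x exprMn ler_piMr ?sqr_ge0//; nra.
have x1 : x <= 1 / 4 by rewrite /x; nra.
have x2 : - (1 / 4) <= x by rewrite /x; nra.
rewrite (_ : 2 * l * v = 2 * x); last by rewrite /x mulrA.
nra.
Qed.

Context (t n : nat) (X : 'I_t * 'I_n -> T -> R).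
Hypothesis iidX : iid P measurable (normal_prob 0 1) X.

Let chi2 (u : 'I_n -> R) (w : T) : R := \sum_(j < t) row_form X u j w ^+ 2.

(** Chernoff bound on each tail. The exponent is quadratic in [tau] up to 1 and linear beyond; the
    linear regime serves the large distortions needed when [t] is far below [r]. *)
Lemma chi_square_deviation (u : 'I_n -> R) (tau : R) :
    \sum_i u i ^+ 2 <= 1 -> 0 < tau ->
  (P [set w | t%:R * tau <= `|chi2 u w - t%:R * \sum_i u i ^+ 2| ]%R <=
   (2 * expR (- (t%:R * (Num.min tau 1 * tau / 16))))%:E)%E.
Proof.
set v := \sum_i _; set a := Num.min tau 1 => v1 tau0.
have v0 : 0 <= v by apply: sumr_ge0 => i _; exact: sqr_ge0.
have a0 : 0 < a by rewrite lt_min tau0 ltr01.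
have a1 : a <= 1 by rewrite ge_min lexx orbT.
have atau : a <= tau by rewrite ge_min lexx.
have mchi2 := measurable_sum_row_form iidX u.
(* With [|l| = a / 8] the exponent per row is [- a tau / 8 + a^2 / 16], at most [- a tau / 16] as
   [a <= tau]; and [a <= 1] keeps [|l| <= 1/4]. *)
have tail (l : R) : `|l| = a / 8 ->
    (P [set w | t%:R * (l * v + `|l| * tau) <= l * chi2 u w]%R <=
     (expR (- (t%:R * (a * tau / 16))))%:E)%E.
  move=> la.
  have l4 : `|l| <= 1 / 4 by rewrite la; lra.
  have q0 : 0 < 1 - 2 * l * v by move: l4; rewrite ler_norml => /andP[]; nra.
  apply: (le_trans (expR_markov _ _)); first exact: measurable_funM.
  rewrite (chi_square_mgf iidX)// -EFinM lee_fin.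
  apply: (@le_trans _ _ (expR (- (t%:R * (l * v + `|l| * tau))) *
      expR (t%:R * (l * v + 4 * l ^+ 2)))).
    by rewrite ler_wpM2l ?expR_ge0// chi_square_mgf_bound.
  rewrite -expRD ler_expR -mulrN -mulrDr -mulrN ler_wpM2l//.
  rewrite -[l ^+ 2]real_normK ?num_real// la; nra.
have la : `|a / 8| = a / 8 by rewrite ger0_norm// divr_ge0// ltW.
set E1 := [set w | t%:R * (a / 8 * v + `|a / 8| * tau) <= a / 8 * chi2 u w].
set E2 := [set w | t%:R * (- (a / 8) * v + `|- (a / 8)| * tau) <= - (a / 8) * chi2 u w].
have mE (l b : R) : measurable [set w | b <= l * chi2 u w].
  by apply: measurable_superlevel; exact: measurable_funM.
have mE1 : measurable E1 by exact: mE.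
have mE2 : measurable E2 by exact: mE.
apply: (@le_trans _ _ (P (E1 `|` E2))).
  apply: le_measure; rewrite ?inE.
  - apply: measurable_superlevel; apply: measurableT_comp => //.
    exact: measurable_funB.
  - exact: measurableU.
  move=> w /=; rewrite ler_normr => /orP[H|H]; [left|right].
    by rewrite /E1 /= la; nra.
  by rewrite /E2 /= normrN la; nra.
apply: (le_trans (measureU2 _ mE1 mE2)).
rewrite mulr_natl mulr2n EFinD leeD// tail// normrN//.
Qed.

Lemma sqn_rescaled_matrix (w : T) (y : 'cV[R]_n) : (0 < t)%N ->
  t%:R * sqn (rescaled_matrix X w *m y) = chi2 (fun i => y i 0) w.
Proof.
move=> t0; rewrite /rescaled_matrix -scalemxAl sqnZ exprVn sqr_sqrtr// mulrA.
rewrite divff ?mul1r ?pnatr_eq0 -?lt0n//.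
apply: eq_bigr => j _; rewrite mxE; congr (_ ^+ 2).
by apply: eq_bigr => i _; rewrite mxE mulrC.
Qed.

(** The net lemma is applied to the quadratic form [|G U y|^2 - |y|^2], where [G] is the sketch. The
    factor [2 ^ (18 * e)] is the union bound over the net, and the distortion [3 * tau] is the price
    of passing from the net to all [y]. *)
Lemma gaussian_near_isometry (e : nat) (U : 'M[R]_(n, e)) (tau : R) :
    (0 < t)%N -> U^T *m U = 1%:M -> 0 < tau ->
  prob_ge P
    [set w | forall y : 'cV[R]_e,
      `|sqn (rescaled_matrix X w *m (U *m y)) - sqn y| <= 3 * tau * sqn y]
    (1 - (2 ^ (18 * e))%:R *
      (2 * expR (- (t%:R * (Num.min tau 1 * tau / 16))))).
Proof.
move=> t0 UU tau0.
pose u (z : grid e) i := (U *m grid_point z : 'cV[R]_n) i 0.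
pose bad z := [set w | t%:R * tau <= `|chi2 (u z) w - t%:R * \sum_i u z i ^+ 2| ].
have mbad z : measurable (bad z).
  have mchi2 := measurable_sum_row_form iidX (u z).
  apply: measurable_superlevel; apply: measurableT_comp => //.
  exact: measurable_funB.
have uz z : \sum_i u z i ^+ 2 = sqn (grid_point z) by rewrite -(sqn_isometry _ UU).
have tR : 0 < t%:R :> R by rewrite ltr0n.
pose F := \big[setU/set0]_(z <- enum (@in_ball e)) bad z.
have mF : measurable F by exact: bigsetU_measurable.
exists (~` F); split; first exact: measurableC.
- move=> w /= Fw.
  have good z : in_ball z -> `|sqn (rescaled_matrix X w *m (U *m grid_point z)) -
      sqn (grid_point z)| <= tau.
    move=> zb; rewrite leNgt; apply/negP => H; apply: Fw.
    rewrite /F -bigcup_seq; exists z; first by rewrite /= mem_enum.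
    rewrite /bad /= -/(u z) uz -sqn_rescaled_matrix// -mulrBr normrM gtr0_norm//.
    by rewrite ler_pM2l// ltW.
  apply: (quadratic_form_net
    (C := frobenius_sqr (rescaled_matrix X w *m U) + 1) _ _ _ good).
  + by move=> a x; rewrite -!scalemxAr !sqnZ mulrBr.
  + move=> x y; set G := rescaled_matrix X w.
    transitivity (4 * (sqn (G *m (U *m x)) - sqn (G *m (U *m y))) - 4 * (sqn x - sqn y)).
      by ring.
    rewrite !sqn_polarization.
    rewrite !(mulmxDr, mulmxBr, mulmxN) -!scalemxAr !(mulmxDr, mulmxBr, mulmxN).
    by ring.
  + move=> x; rewrite mulrDl mul1r (le_trans (ler_normB _ _))//.
    by rewrite !ger0_norm ?sqn_ge0// lerD2r mulmxA sqn_mulmx_le.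
rewrite probability_setC// EFinB leeB//.
apply: (le_trans (measure_bigsetU_le _ mbad)).
apply: (@le_trans _ _ (\sum_(z <- enum (@in_ball e))
    (2 * expR (- (t%:R * (Num.min tau 1 * tau / 16))))%:E)%E).
  rewrite !big_seq; apply: lee_sum => z; rewrite mem_enum => zb.
  by apply: chi_square_deviation => //; rewrite uz sqn_grid_point.
rewrite sumEFin lee_fin big_enum sumr_const -[_ *+ #|_|]mulr_natl ler_wpM2r//.
  by rewrite ler_nat card_in_ball.
Qed.

End Concentration.

(** * Projections and the singular value decomposition *)

Section Projection.
Context {R : realType}.

Lemma proj_rows_kernel m t (C : 'M[R]_(t, m)) (x : 'cV[R]_m) :
  C *m (x - mpinv C *m C *m x) = 0.
Proof. by have [CXC _ _ _] := mpinvP C; rewrite mulmxBr !mulmxA CXC subrr. Qed.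

Lemma sub_proj_rows n m t (A : 'M[R]_(n, m)) (C : 'M[R]_(t, m)) (x : 'cV[R]_m) :
  (A - proj_rows C A) *m x = A *m (x - mpinv C *m C *m x).
Proof. by rewrite mulmxBl mulmxBr /proj_rows !mulmxA. Qed.

(** Pythagoras: [mpinv C *m C] is symmetric and idempotent, hence an orthogonal projector. *)
Lemma sqn_proj_rows m t (C : 'M[R]_(t, m)) (x : 'cV[R]_m) :
  sqn (mpinv C *m C *m x) + sqn (x - mpinv C *m C *m x) = sqn x.
Proof.
have [_ XCX _ symXC] := mpinvP C.
set p := _ *m x.
have pp : dotp x p = sqn p.
  have idem : mpinv C *m C *m (mpinv C *m C) = mpinv C *m C by rewrite mulmxA XCX.
  rewrite -dotpp !dotp_mx /p trmx_mul symXC -(mulmxA x^T).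
  by rewrite (mulmxA (mpinv C *m C) (mpinv C *m C)) idem.
by rewrite sqnB pp; ring.
Qed.

Lemma eq_mulmx_col m n (A B : 'M[R]_(m, n)) :
  (forall y : 'cV[R]_n, A *m y = B *m y) -> A = B.
Proof.
move=> AB; apply/matrixP => i j.
have := AB (delta_mx j 0); rewrite -!colE => /matrixP/(_ i 0).
by rewrite !mxE.
Qed.

(** [A - B] splits as [(A - P_C(A)) + (P_C(A) - B)]. The first term is [A] composed with the
    projector onto the kernel of [C], which costs [b]; optimality of [B] costs 1. *)
Lemma projected_approx_le_kernel n m t (A : 'M[R]_(n, m)) (C : 'M[R]_(t, m))
    (k : nat) (b : R) : 0 <= b ->
    (forall (Ak : 'M[R]_(n, m)) (y : 'cV[R]_m), (\rank Ak <= k)%N ->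
      C *m y = 0 -> l2norm (A *m y) <= b * spectral_norm (A - Ak) * l2norm y) ->
  projected_approx_le A C k (b + 1).
Proof.
move=> b0 AC Ak B [rAk _] [rB minB].
have N0 := spectral_norm_ge0 (A - Ak).
have normP (x : 'cV[R]_m) : l2norm (mpinv C *m C *m x) <= l2norm x.
  by rewrite !l2norm_sqn ler_wsqrtr// -[leRHS](sqn_proj_rows C x) lerDl sqn_ge0.
have normQ (x : 'cV[R]_m) : l2norm (x - mpinv C *m C *m x) <= l2norm x.
  by rewrite !l2norm_sqn ler_wsqrtr// -[leRHS](sqn_proj_rows C x) lerDr sqn_ge0.
have AP (x : 'cV[R]_m) :
    l2norm ((A - proj_rows C A) *m x) <= b * spectral_norm (A - Ak) * l2norm x.
  rewrite sub_proj_rows (le_trans (AC _ _ rAk (proj_rows_kernel C x)))//.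
  by rewrite ler_wpM2l ?mulr_ge0.
have PB : spectral_norm (proj_rows C A - B) <= spectral_norm (A - Ak).
  (* The competitor of [B] is the projection of [Ak]: its rank is at most [k] and projecting does
     not increase the error. *)
  have rP : (\rank (proj_rows C Ak) <= k)%N.
    by rewrite /proj_rows -mulmxA (leq_trans (mxrankM_maxl _ _)).
  apply: le_trans (minB _ rP) _; apply: spectral_norm_le => // x.
  rewrite /proj_rows -!mulmxA -mulmxBl -mulmxA.
  by rewrite (le_trans (l2norm_spectral _ _))// ler_wpM2l.
apply: spectral_norm_le => [x|]; last by rewrite mulr_ge0// addr_ge0.
have -> : A - B = A - proj_rows C A + (proj_rows C A - B) by rewrite addrA subrK.
rewrite mulmxDl (le_trans (l2normD _ _))// mulrDl mul1r mulrDl lerD//.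
by rewrite (le_trans (l2norm_spectral _ _))// ler_wpM2r ?l2norm_ge0.
Qed.

Lemma projected_approx_le_exact n m t (A : 'M[R]_(n, m)) (C : 'M[R]_(t, m))
    (k : nat) (a : R) :
    1 <= a -> (forall y : 'cV[R]_m, C *m y = 0 -> A *m y = 0) ->
  projected_approx_le A C k a.
Proof.
move=> a1 AC Ak B [rAk _] [rB minB].
have PA : proj_rows C A = A.
  apply/esym/eqP; rewrite -subr_eq0; apply/eqP; apply: eq_mulmx_col => y.
  by rewrite sub_proj_rows mul0mx AC// proj_rows_kernel.
move: minB; rewrite PA => /(_ Ak rAk)/le_trans; apply.
by rewrite ler_peMl// spectral_norm_ge0.
Qed.

End Projection.

Section SVD.
Context {R : realType}.

Lemma svd_mulmx n m r (A : 'M[R]_(n, m)) (U : 'M[R]_(n, r)) (s : 'rV[R]_r)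
    (V : 'M[R]_(m, r)) (y : 'cV[R]_m) :
  is_svd A U s V -> A *m y = U *m (diag_mx s *m (V^T *m y)).
Proof. by case=> _ _ _ _ ->; rewrite !mulmxA. Qed.

Lemma diag_mx_mulE r (s : 'rV[R]_r) (z : 'cV[R]_r) i :
  (diag_mx s *m z) i 0 = s 0 i * z i 0.
Proof. by rewrite mul_diag_mx mxE. Qed.

(** Bessel's inequality, from the nonnegative squared residual. *)
Lemma sqn_isometry_tr m r (V : 'M[R]_(m, r)) (y : 'cV[R]_m) :
  V^T *m V = 1%:M -> sqn (V^T *m y) <= sqn y.
Proof.
move=> VV; have := sqn_ge0 (y - V *m (V^T *m y)).
rewrite sqnB sqn_isometry//.
have -> : dotp y (V *m (V^T *m y)) = sqn (V^T *m y).
  by rewrite -dotpp !dotp_mx trmx_mul trmxK !mulmxA.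
by move=> ?; lra.
Qed.

(* The lower bound of the Eckart-Young theorem: the span of the first [k + 1]
   right singular vectors meets the kernel of [B]. *)
Lemma eckart_young n m r (A : 'M[R]_(n, m)) (U : 'M[R]_(n, r)) (s : 'rV[R]_r)
    (V : 'M[R]_(m, r)) (B : 'M[R]_(n, m)) (k : 'I_r) :
  is_svd A U s V -> (\rank B <= k)%N -> s 0 k <= spectral_norm (A - B).
Proof.
move=> svd rB; have [UU VV s0 smono _] := svd.
(* Ordinals start at 0, so [s 0 k] is singular value number [k + 1]; the [k + 1] columns of [W]
   exceed the rank of [B], which yields a nonzero [z]. *)
pose W : 'M[R]_(r, k.+1) := \matrix_(i, j) (i == j :> nat)%:R.
have [z z0 BVWz] : exists2 z : 'cV[R]_k.+1, z != 0 & B *m (V *m (W *m z)) = 0.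
  have : \rank (B *m V *m W) != k.+1.
    rewrite neq_ltn (leq_ltn_trans _ (ltnSn k))// (leq_trans _ rB)//.
    by rewrite -mulmxA mxrankM_maxl.
  rewrite -mxrank_tr -/(row_free _) -kermx_eq0 => /rowV0Pn[v /sub_kermxP vk v0].
  exists v^T; first by apply: contra v0 => /eqP v0; rewrite -[v]trmxK v0 trmx0.
  by apply: trmx_inj; rewrite trmx0 -vk !trmx_mul trmxK !mulmxA.
have WzE (i : 'I_r) : (W *m z) i 0 = if (i <= k)%N then z (inord i) 0 else 0.
  rewrite mxE; case: ifPn => [ik|ik].
    rewrite (bigD1 (inord i))//= mxE inordK// eqxx mul1r big1 ?addr0// => j ji.
    rewrite mxE; case: eqP => [ij|]; last by rewrite mul0r.
    by case/eqP: ji; apply: val_inj; rewrite /= inordK// ij.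
  rewrite big1// => j _; rewrite mxE; case: eqP => [ij|]; last by rewrite mul0r.
  by case/negP: ik; rewrite ij -ltnS.
pose x := V *m (W *m z).
have sx : sqn x = sqn (W *m z) by rewrite /x sqn_isometry.
have Wz0 : 0 < sqn (W *m z).
  rewrite lt_neqAle sqn_ge0 andbT eq_sym; apply: contra z0 => /eqP/sqn_eq0 Wz0.
  apply/eqP/matrixP => j i; rewrite (ord1 i) mxE.
  have jr : (j < r)%N by rewrite (leq_trans (ltn_ord j)).
  have := WzE (Ordinal jr); rewrite Wz0 mxE /= -ltnS ltn_ord => ->.
  by rewrite inord_val.
have lx0 : 0 < l2norm x by rewrite l2norm_sqn sqrtr_gt0 sx.
rewrite -(ler_pM2r lx0); apply: le_trans (l2norm_spectral _ _).
have -> : (A - B) *m x = U *m (diag_mx s *m (W *m z)).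
  rewrite mulmxBl BVWz subr0 (svd_mulmx _ svd) /x.
  by rewrite (mulmxA V^T) VV mul1mx.
rewrite l2norm_isometry// !l2norm_sqn sx.
have -> : s 0 k = Num.sqrt (s 0 k ^+ 2) by rewrite sqrtr_sqr gtr0_norm.
rewrite -sqrtrM ?sqr_ge0// ler_wsqrtr// mulr_sumr; apply: ler_sum => i _.
rewrite diag_mx_mulE exprMn WzE; case: ifPn => ik; last by rewrite expr0n/= !mulr0.
by rewrite ler_wpM2r ?sqr_ge0//; apply: lerXn2r; rewrite ?nnegrE;
  [exact: ltW|exact: ltW|exact: smono].
Qed.

End SVD.

(** * From the behaviour of the sketch on left singular vectors to the approximation error *)

Section KernelBound.
Context {R : realType}.

Lemma projected_approx_le_mono n m t (A : 'M[R]_(n, m)) (C : 'M[R]_(t, m))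
    (k : nat) (a b : R) : a <= b ->
  projected_approx_le A C k a -> projected_approx_le A C k b.
Proof.
move=> ab H Ak B bA bB; apply: le_trans (H Ak B bA bB) _.
by rewrite ler_wpM2r// spectral_norm_ge0.
Qed.

Definition first_coords (r k : nat) : 'M[R]_(r, k) := \matrix_(i, j) (i == j :> nat)%:R.

Lemma first_coords_isometry (r k : nat) : (k <= r)%N ->
  (first_coords r k)^T *m first_coords r k = 1%:M.
Proof.
move=> kr; apply/matrixP => i j; rewrite !mxE.
rewrite (bigD1 (widen_ord kr i))//= !mxE eqxx mul1r big1 ?addr0// => l li.
by rewrite !mxE (_ : (l == i :> nat) = false) ?mul0r//; apply: negbTE.
Qed.

Lemma first_coordsE (r k : nat) (a : 'cV[R]_r) (i : 'I_r) :
  (first_coords r k *m ((first_coords r k)^T *m a)) i 0 =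
  if (i < k)%N then a i 0 else 0.
Proof.
rewrite mxE; case: ifPn => ik.
  rewrite (bigD1 (Ordinal ik))//= !mxE eqxx mul1r (bigD1 i)//= !mxE eqxx mul1r.
  rewrite !big1 ?addr0// => j ji.
    by rewrite !mxE (_ : (i == j :> nat) = false) ?mul0r// eq_sym; apply: negbTE.
  by rewrite !mxE (_ : (j == i :> nat) = false) ?mul0r//; apply: negbTE.
rewrite big1// => j _; rewrite mxE (_ : (i == j :> nat) = false) ?mul0r//.
by apply/negbTE; apply: contra ik => /eqP ->.
Qed.

(* If [G A y = 0] and [a = S V^T y] is split as [a1 + a2] along the first [k]
   coordinates, then [G U a1 = - G U a2], which controls [a1] by [a2]. *)
Lemma l2norm_kernel_le n m r t (A : 'M[R]_(n, m)) (U : 'M[R]_(n, r))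
    (s : 'rV[R]_r) (V : 'M[R]_(m, r)) (G : 'M[R]_(t, n)) (k : 'I_r) (c : R)
    (y : 'cV[R]_m) :
    is_svd A U s V -> 0 <= c ->
    (forall b : 'cV[R]_k, 1 / 2 * sqn b <= sqn (G *m (U *m first_coords r k *m b))) ->
    (forall a : 'cV[R]_r, sqn (G *m (U *m a)) <= c * sqn a) ->
    G *m A *m y = 0 ->
  l2norm (A *m y) <= (1 + Num.sqrt (2 * c)) * s 0 k * l2norm y.
Proof.
move=> svd c0 Glow Gup GAy; have [UU VV s0 smono _] := svd.
pose a := diag_mx s *m (V^T *m y).
have AyE : A *m y = U *m a by exact: svd_mulmx svd.
pose b := (first_coords r k)^T *m a.
pose a1 := first_coords r k *m b; pose a2 := a - a1.
have GUa : G *m (U *m a1) = - (G *m (U *m a2)).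
  by apply/eqP; rewrite -subr_eq0 opprK -!mulmxDr addrC subrK -AyE mulmxA GAy.
have a1E : sqn a1 = sqn b by rewrite /a1 sqn_isometry// first_coords_isometry// ltnW.
have a1a2 : sqn a1 <= 2 * c * sqn a2.
  have := Glow b; rewrite -(mulmxA U) GUa sqnN -a1E => H.
  have := Gup a2 => H'; lra.
(* Only the coordinates from [k] on survive in [a2], and there the singular values are at most
   [s 0 k]. *)
have a2y : sqn a2 <= s 0 k ^+ 2 * sqn y.
  apply: (@le_trans _ _ (s 0 k ^+ 2 * sqn (V^T *m y))); last first.
    by rewrite ler_wpM2l ?sqr_ge0// sqn_isometry_tr.
  rewrite mulr_sumr; apply: ler_sum => i _.
  rewrite /a2 /a1 mxE [X in _ + X]mxE first_coordsE; case: ltnP => ik.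
    by rewrite subrr expr0n mulr_ge0// sqr_ge0.
  rewrite subr0 diag_mx_mulE exprMn ler_wpM2r ?sqr_ge0//.
  apply: lerXn2r; rewrite ?nnegrE; [exact: ltW|exact: ltW|exact: smono].
have la2 : l2norm a2 <= s 0 k * l2norm y.
  apply: l2norm_sqr_le; last by rewrite exprMn l2norm_sqr.
  by rewrite mulr_ge0 ?l2norm_ge0// ltW.
have la1 : l2norm a1 <= Num.sqrt (2 * c) * l2norm a2.
  have c20 : 0 <= 2 * c by rewrite mulr_ge0.
  apply: l2norm_sqr_le; first by rewrite mulr_ge0 ?l2norm_ge0 ?sqrtr_ge0.
  by rewrite exprMn l2norm_sqr sqr_sqrtr.
rewrite AyE l2norm_isometry// (_ : a = a2 + a1); last by rewrite subrK.
rewrite (le_trans (l2normD _ _))// -mulrA mulrDl mul1r lerD//.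
by rewrite (le_trans la1)// ler_wpM2l ?sqrtr_ge0.
Qed.

Lemma projected_approx_le_svd n m r t (A : 'M[R]_(n, m)) (U : 'M[R]_(n, r))
    (s : 'rV[R]_r) (V : 'M[R]_(m, r)) (G : 'M[R]_(t, n)) (k : 'I_r) (c : R) :
    is_svd A U s V -> 0 <= c ->
    (forall b : 'cV[R]_k, 1 / 2 * sqn b <= sqn (G *m (U *m first_coords r k *m b))) ->
    (forall a : 'cV[R]_r, sqn (G *m (U *m a)) <= c * sqn a) ->
  projected_approx_le A (G *m A) k (2 + Num.sqrt (2 * c)).
Proof.
move=> svd c0 Glow Gup.
rewrite (_ : 2 + _ = 1 + Num.sqrt (2 * c) + 1); last by ring.
have b0 : 0 <= 1 + Num.sqrt (2 * c) by rewrite addr_ge0// sqrtr_ge0.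
apply: projected_approx_le_kernel => // Ak y rAk GAy.
apply: le_trans (l2norm_kernel_le svd c0 Glow Gup GAy) _.
rewrite ler_wpM2r ?l2norm_ge0// ler_wpM2l//; exact: eckart_young svd rAk.
Qed.

Lemma projected_approx_le_injective n m r t (A : 'M[R]_(n, m)) (U : 'M[R]_(n, r))
    (s : 'rV[R]_r) (V : 'M[R]_(m, r)) (C : 'M[R]_(t, m)) (k : nat) (a : R) :
    is_svd A U s V -> 1 <= a ->
    (forall (x : 'cV[R]_r) (y : 'cV[R]_m), A *m y = U *m x -> C *m y = 0 -> x = 0) ->
  projected_approx_le A C k a.
Proof.
move=> svd a1 CU; apply: projected_approx_le_exact => // y Cy.
have AyE := svd_mulmx y svd.
by rewrite AyE (CU _ _ AyE Cy) mulmx0.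
Qed.

End KernelBound.

(** * Spanning by random rows *)

Section Tuples.
Context {R : realType} (S : finType).

Lemma big_tuple_cons t (F : t.+1.-tuple S -> R) :
  \sum_(u : t.+1.-tuple S) F u =
  \sum_(x : S) \sum_(u : t.-tuple S) F [tuple of x :: u].
Proof.
rewrite pair_bigA /=.
rewrite (reindex (fun p : S * t.-tuple S => [tuple of p.1 :: p.2]))//=.
exists (fun u : t.+1.-tuple S => (thead u, [tuple of behead u])) => [[x u] _|u _] /=.
  by congr (_, _); apply: val_inj.
by rewrite [RHS]tuple_eta.
Qed.

Lemma sum_tuple_prod t (w : S -> R) :
  \sum_(u : t.-tuple S) \prod_(x <- u) w x = (\sum_x w x) ^+ t.
Proof.
elim: t => [|t IHt].
  rewrite (eq_bigr (fun=> 1)) => [|u _]; last by rewrite tuple0 big_nil.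
  by rewrite sumr_const card_tuple expn0.
rewrite big_tuple_cons exprS mulr_suml; apply: eq_bigr => x _.
rewrite -IHt mulr_sumr; apply: eq_bigr => u _.
by rewrite big_cons.
Qed.

End Tuples.

Section RankGrowth.
Context {R : realType} (S : finType) (w : S -> R) (r : nat) (g : S -> 'rV[R]_r).
Context (phi : nat -> R) (rho : R).

Definition span_from (W : 'M[R]_r) (u : seq S) : 'M[R]_r :=
  foldl (fun M x => (M + g x)%MS) W u.

Definition spanning (u : seq S) : bool := \rank (span_from 0 u) == r.

Lemma span_from_sub (W : 'M[R]_r) (u : seq S) q (G : 'M[R]_(q, r)) :
  (W <= G)%MS -> (forall x, x \in u -> (g x <= G)%MS) -> (span_from W u <= G)%MS.
Proof.
elim: u W => [//|x u IHu] W WG uG /=; apply: IHu => [|y yu].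
  by rewrite addsmx_sub WG uG ?mem_head.
by apply: uG; rewrite inE yu orbT.
Qed.

Lemma spanning_injective (u : seq S) (a : 'cV[R]_r) : spanning u ->
  (forall x, x \in u -> g x *m a = 0) -> a = 0.
Proof.
move=> /eqP ru ua.
have : (span_from 0 u <= kermx a)%MS.
  by apply: span_from_sub => [|x xu]; [exact: sub0mx|apply/sub_kermxP; exact: ua].
have u1 : (1%:M <= span_from 0 u)%MS by rewrite sub1mx /row_full ru.
by move=> /(submx_trans u1)/sub_kermxP; rewrite mul1mx.
Qed.

Hypotheses (w0 : forall x, 0 <= w x) (rho0 : 0 <= rho).
Hypothesis step : forall W : 'M[R]_r,
  \sum_x w x * phi (r - \rank (W + g x)%MS) <= rho * phi (r - \rank W).

(** [phi] is a potential of the codimension: each new row contracts its mean by [rho], whatever the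
    span [W] reached so far. *)
Lemma rank_growth t (W : 'M[R]_r) :
  \sum_(u : t.-tuple S) (\prod_(x <- u) w x) * phi (r - \rank (span_from W u)) <=
  rho ^+ t * phi (r - \rank W).
Proof.
elim: t W => [|t IHt] W.
  rewrite (eq_bigr (fun=> phi (r - \rank W))) => [|u _]; last first.
    by rewrite tuple0 big_nil mul1r.
  by rewrite sumr_const card_tuple expn0 mul1r.
rewrite big_tuple_cons.
apply: (@le_trans _ _ (\sum_x w x * (rho ^+ t * phi (r - \rank (W + g x)%MS)))).
  apply: ler_sum => x _; apply: le_trans (ler_wpM2l (w0 x) (IHt _)).
  rewrite mulr_sumr le_eqVlt; apply/orP; left; apply/eqP.
  by apply: eq_bigr => u _; rewrite /= big_cons mulrA.
rewrite exprSr -mulrA; under eq_bigr do rewrite mulrCA.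
by rewrite -mulr_sumr ler_wpM2l// exprn_ge0.
Qed.

(** Markov's inequality for the potential: it is at least 1 while the span is proper, and it starts
    at [phi r]. *)
Lemma not_spanning_weight_le t : (forall d, 0 <= phi d) ->
    (forall d, (0 < d)%N -> 1 <= phi d) ->
  \sum_(u : t.-tuple S | ~~ spanning u) \prod_(x <- u) w x <= rho ^+ t * phi r.
Proof.
move=> phi0 phi1; have := rank_growth t 0; rewrite mxrank0 subn0.
apply: le_trans; rewrite [leRHS](bigID (fun u : t.-tuple S => spanning u))/=.
rewrite ler_wpDl//.
  by apply: sumr_ge0 => u _; rewrite mulr_ge0// prodr_ge0.
apply: ler_sum => u nu; rewrite ler_peMr ?prodr_ge0// phi1//.
by rewrite subn_gt0 ltn_neqAle nu rank_leq_row.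
Qed.

End RankGrowth.

(** * Codimension and leverage outside a subspace *)

Section RankStep.
Context {R : realType}.

Lemma mxrank_add_row r (W : 'M[R]_r) (v : 'rV[R]_r) :
  \rank (W + v)%MS = (\rank W + ~~ (v <= W)%MS)%N.
Proof.
have [vW|vW] := boolP (v <= W)%MS.
  rewrite addn0; apply/eqP.
  by rewrite eqn_leq !mxrankS ?addsmx_sub ?submx_refl ?vW ?addsmxSl.
apply/eqP; rewrite eqn_leq; apply/andP; split.
  by rewrite (leq_trans (mxrank_adds_leqif _ _))// leq_add2l rank_leq_row.
rewrite addn1 ltn_neqAle mxrankS ?addsmxSl// andbT.
apply: contra vW => /eqP rW.
have : (W + v <= W)%MS by rewrite -(geq_leqif (mxrank_leqif_sup (addsmxSl W v))) rW.
by rewrite addsmx_sub => /andP[].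
Qed.

Lemma l2norm_sqr_row n (v : 'rV[R]_n) : l2norm v ^+ 2 = sqn v^T.
Proof.
rewrite sqr_sqrtr; last first.
  by apply: sumr_ge0 => i _; apply: sumr_ge0 => j _; exact: sqr_ge0.
by rewrite big_ord1; apply: eq_bigr => j _; rewrite mxE.
Qed.

(** In a full-rank factorization [E = C B], idempotence forces [B C = 1], and the trace is
    cyclic. *)
Lemma mxtrace_idempotent r (E : 'M[R]_r) : E *m E = E -> \tr E = (\rank E)%:R.
Proof.
move=> EE; have BC : row_base E *m col_base E = 1%:M.
  apply: (row_full_inj (col_base_full E)); apply: (row_free_inj (row_base_free E)).
  by rewrite mulmx1 mulmxA mulmx_base -mulmxA mulmx_base EE.
by rewrite -{1}(mulmx_base E) mxtrace_mulC BC mxtrace1.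
Qed.

(* [Q] is the orthogonal projector on the orthogonal complement of the row
   space of [W]; its trace is its rank. *)
Lemma leverage_outside n r (U : 'M[R]_(n, r)) (W : 'M[R]_r) :
    U^T *m U = 1%:M ->
  (r - \rank W)%:R <= \sum_(i | ~~ (row i U <= W)%MS) l2norm (row i U) ^+ 2.
Proof.
move=> UU; have [_ XWX _ symXW] := mpinvP W.
set X := mpinv W in XWX symXW; pose E := X *m W.
have EE : E *m E = E by rewrite /E mulmxA XWX.
pose Q := 1%:M - E.
have QQ : Q *m Q = Q by rewrite /Q mulmxBr mulmx1 mulmxBl mul1mx EE subrr subr0.
have QT : Q^T = Q by rewrite /Q linearB /= trmx1 /E symXW.
have trQ : \tr Q = r%:R - (\rank E)%:R.
  by rewrite /Q linearB /= mxtrace1 mxtrace_idempotent.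
apply: (@le_trans _ _ (\tr Q)).
  rewrite trQ natrB ?rank_leq_row// lerD2l lerN2 ler_nat.
  exact: mxrankM_maxr.
(* [Q = Q^T U^T U Q], so its trace is the squared Frobenius norm of [U Q]. Rows of [U] inside [W]
   are killed by [Q], the others do not grow. *)
have -> : \tr Q = \sum_i \sum_j (U *m Q) i j ^+ 2.
  rewrite -[in LHS]QQ -{1}QT -[X in X *m Q]mulmx1 -UU mulmxA.
  rewrite -trmx_mul -mulmxA mxtrace_mulC.
  by apply: eq_bigr => i _; rewrite mxE; apply: eq_bigr => j _; rewrite [X in _ * X]mxE.
rewrite (bigID (fun i => (row i U <= W)%MS))/= big1 ?add0r.
  apply: ler_sum => i _.
  have -> : \sum_j (U *m Q) i j ^+ 2 = sqn ((row i U)^T - X *m W *m (row i U)^T).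
    apply: eq_bigr => j _; congr (_ ^+ 2).
    have -> : (row i U)^T - X *m W *m (row i U)^T = (row i (U *m Q))^T.
      by rewrite row_mul trmx_mul QT mulmxBl mul1mx.
    by rewrite !mxE.
  rewrite l2norm_sqr_row.
  by rewrite -[leRHS](sqn_proj_rows W) lerDr sqn_ge0.
move=> i /submxP[D iD]; rewrite big1// => j _.
have : row i (U *m Q) = 0.
  have [WXW _ _ _] := mpinvP W.
  by rewrite row_mul iD -mulmxA /Q mulmxBr mulmx1 /E mulmxA WXW subrr mulmx0.
by move/matrixP/(_ 0 j); rewrite !mxE => ->; rewrite expr0n.
Qed.
End RankStep.

Section ProbGe.
Context {R : realType} d (T : measurableType d) (P : probability T R).

Lemma prob_ge_weaken (A B : set T) (a b : R) :
  b <= a -> A `<=` B -> prob_ge P A a -> prob_ge P B b.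
Proof.
move=> ba AB [E [mE EA PE]]; exists E; split=> //; first exact: subset_trans AB.
by apply: le_trans PE; rewrite lee_fin.
Qed.

Lemma prob_geI (A B : set T) (a b : R) :
  prob_ge P A (1 - a) -> prob_ge P B (1 - b) -> prob_ge P (A `&` B) (1 - (a + b)).
Proof.
move=> [E [mE EA PE]] [F [mF FB PF]]; exists (E `&` F); split.
- exact: measurableI.
- exact: setISS.
have fin (G : set T) : measurable G -> P G = (fine (P G))%:E.
  by move=> mG; rewrite fineK// fin_num_measure.
have := probability_setC P (measurableI _ _ mE mF).
have : (P (~` (E `&` F)) <= P (~` E) + P (~` F))%E.
  by rewrite setCI; apply: measureU2; exact: measurableC.
rewrite !probability_setC//; last exact: measurableI.
move: PE PF; rewrite (fin E)// (fin F)// (fin (E `&` F)); last exact: measurableI.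
by rewrite -!EFinB -EFinD !lee_fin => ? ? ? _; lra.
Qed.

Lemma measure_bigsetU_disjoint (I : choiceType) (s : seq I) (F : I -> set T) :
    uniq s -> (forall i, measurable (F i)) ->
    (forall i j w, F i w -> F j w -> i = j) ->
  P (\big[setU/set0]_(i <- s) F i) = (\sum_(i <- s) P (F i))%E.
Proof.
move=> + mF tF; elim: s => [_|i s IHs /= /andP[is0 us]].
  by rewrite !big_nil measure0.
rewrite !big_cons measureU//; [by congr (_ + _)%E; exact: IHs|exact: bigsetU_measurable|].
apply/seteqP; split=> // w [Fi]; rewrite -bigcup_seq => -[j /= js Fj].
by move: is0; rewrite (tF _ _ _ Fi Fj) js.
Qed.

Context (t : nat) (S : finType) (C : 'I_t -> S -> set T) (wt : S -> R).
Context (r : nat) (g : S -> 'rV[R]_r).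

(** [C j x] is the event that draw [j] has outcome [x]. Distinct outcome tuples are disjoint events
    with product weights of total 1, so the probability becomes a finite sum over spanning
    tuples. *)
Lemma prob_ge_spanning (b : R) :
    (forall j x, measurable (C j x)) ->
    (forall j x y w, C j x w -> C j y w -> x = y) ->
    (forall u : t.-tuple S,
      P (\bigcap_(j in [set: 'I_t]) C j (tnth u j)) = (\prod_(x <- u) wt x)%:E) ->
    \sum_x wt x = 1 ->
    \sum_(u : t.-tuple S | ~~ spanning g u) \prod_(x <- u) wt x <= b ->
  prob_ge P [set w | exists2 u : t.-tuple S, spanning g u & forall j, C j (tnth u j) w]
    (1 - b).
Proof.
move=> mC dC PC wt1 bb.
pose F (u : t.-tuple S) := \bigcap_(j in [set: 'I_t]) C j (tnth u j).
have mF u : measurable (F u) by exact: fin_bigcap_measurable.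
have dF u v w : F u w -> F v w -> u = v.
  by move=> Fu Fv; apply: eq_from_tnth => j; apply: dC (Fu j I) (Fv j I).
pose E := \big[setU/set0]_(u <- enum (fun u : t.-tuple S => spanning g u)) F u.
exists E; split; first exact: bigsetU_measurable.
- move=> w; rewrite /E -bigcup_seq => -[u /=]; rewrite mem_enum => su Fu.
  by exists u => // j; exact: Fu.
rewrite /E measure_bigsetU_disjoint ?enum_uniq//.
under eq_bigr do rewrite PC.
rewrite sumEFin lee_fin big_enum/= lerBlDr.
have := sum_tuple_prod t wt; rewrite wt1 expr1n => {1}<-.
by rewrite (bigID (fun u : t.-tuple S => spanning g u))/= lerD2l.
Qed.

End ProbGe.

Section Steps.
Context {R : realType} (S : finType) (wt : S -> R) (r : nat) (g : S -> 'rV[R]_r).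
Hypotheses (wt1 : \sum_x wt x = 1).

(** The potential takes two values after one step: unchanged if the row lies in [W], at codimension
    one less otherwise. *)
Lemma rank_step_sum (phi : nat -> R) (W : 'M[R]_r) :
    (\rank W < r)%N ->
  \sum_x wt x * phi (r - \rank (W + g x)%MS)%N =
  phi (r - \rank W).-1%N +
  (phi (r - \rank W)%N - phi (r - \rank W).-1%N) * \sum_(x | (g x <= W)%MS) wt x.
Proof.
move=> rW; set p' := phi _.-1%N; set p := phi (r - \rank W)%N.
rewrite (bigID (fun x => (g x <= W)%MS))/=.
rewrite (eq_bigr (fun x => wt x * p)) => [|x gW]; last first.
  by rewrite mxrank_add_row gW addn0.
rewrite [X in _ + X](eq_bigr (fun x => wt x * p')) => [|x gW]; last first.
  by rewrite mxrank_add_row gW addn1 subnS.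
rewrite -!mulr_suml.
have := wt1; rewrite (bigID (fun x => (g x <= W)%MS))/=.
move: (\sum_(x | _) _) (\sum_(x | ~~ _) _) => q q' qq.
by rewrite -[q'](addrK q) (addrC q') qq; ring.
Qed.

Lemma rank_step_full (phi : nat -> R) (W : 'M[R]_r) :
    phi 0%N = 0 -> \rank W = r ->
  \sum_x wt x * phi (r - \rank (W + g x)%MS)%N = 0.
Proof.
move=> phi0 rW; apply: big1 => x _; rewrite (_ : _ - _ = 0)%N ?phi0 ?mulr0//.
by apply/eqP; rewrite subn_eq0 -{1}rW mxrankS// addsmxSl.
Qed.

End Steps.

Section LeverageStep.
Context {R : realType} (n r : nat) (U : 'M[R]_(n, r)).
Hypotheses (UU : U^T *m U = 1%:M) (r0 : (0 < r)%N).
Hypothesis lev1 : \sum_i leverage_prob U i = 1.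

Lemma leverage_step (W : 'M[R]_r) :
  \sum_i leverage_prob U i * (r - \rank (W + row i U)%MS)%:R <=
  (1 - r%:R^-1) * (r - \rank W)%:R.
Proof.
have [rW|rW] := eqVneq (\rank W) r.
  by rewrite (rank_step_full _ _ (phi := fun k => k%:R))// rW subnn mulr0.
have {}rW : (\rank W < r)%N by rewrite ltn_neqAle rW rank_leq_row.
rewrite (rank_step_sum (fun i => row i U) lev1 (fun k => k%:R))//.
have d0 : (0 < r - \rank W)%N by rewrite subn_gt0.
have := leverage_outside W UU.
have := lev1; rewrite (bigID (fun i => (row i U <= W)%MS))/=.
set q := \sum_(i | _) _; set q' := \sum_(i | ~~ _) leverage_prob U i.
have -> : \sum_(i | ~~ (row i U <= W)%MS) l2norm (row i U) ^+ 2 = q' * r%:R.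
  by rewrite mulr_suml; apply: eq_bigr => i _; rewrite divfK// pnatr_eq0 -lt0n.
rewrite -(prednK d0); set e := (r - _).-1.
rewrite /= -natr1 => qq H.
have : (e%:R + 1) / r%:R <= q' by rewrite ler_pdivrMr// ltr0n.
by move=> {}H; rewrite [leRHS]mulrBl mul1r [_^-1 * _]mulrC; lra.
Qed.

End LeverageStep.

Section SignStep.
Context {R : realType} (n r : nat) (U : 'M[R]_(n, r)).
Hypotheses (UU : U^T *m U = 1%:M).

Lemma sum_sign_weight : \sum_(x : {ffun 'I_n -> bool}) 2^-1 ^+ n = 1 :> R.
Proof.
rewrite sumr_const card_ffun card_bool card_ord -[_ *+ (2 ^ n)]mulr_natl natrX -exprMn.
by rewrite divff ?expr1n.
Qed.

Definition sign_vector (x : {ffun 'I_n -> bool}) : 'rV[R]_n := \row_i (-1) ^+ x i.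

(* Flipping a coordinate [i] with [(U a) i != 0] moves every sign vector out
   of the hyperplane orthogonal to [U a]. *)
Lemma sign_half (W : 'M[R]_r) : (\rank W < r)%N ->
  \sum_(x : {ffun 'I_n -> bool} | (sign_vector x *m U <= W)%MS) 2^-1 ^+ n <= 2^-1 :> R.
Proof.
move=> rW.
have [a a0 Wa] : exists2 a : 'cV[R]_r, a != 0 & W *m a = 0.
  have : \rank W^T != r by rewrite mxrank_tr neq_ltn rW.
  rewrite -/(row_free _) -kermx_eq0 => /rowV0Pn[v /sub_kermxP vW v0].
  exists v^T; first by apply: contra v0 => /eqP v0; rewrite -[v]trmxK v0 trmx0.
  by apply: trmx_inj; rewrite trmx0 -vW trmx_mul trmxK.
have Ua0 : U *m a != 0.
  by apply: contra a0 => /eqP Ua; rewrite -[a]mul1mx -UU -mulmxA Ua mulmx0.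
have [i ui] : exists i, (U *m a) i 0 != 0.
  apply/existsP; apply: contraNT Ua0 => /existsPn H; apply/eqP/matrixP => i j.
  by rewrite (ord1 j) [RHS]mxE; apply/eqP; have := H i; rewrite negbK.
pose flip (x : {ffun 'I_n -> bool}) := [ffun j => if j == i then ~~ x j else x j].
have flipK : involutive flip.
  by move=> x; apply/ffunP => j; rewrite !ffunE; case: eqP => // _; rewrite negbK.
have flipP x : (sign_vector x *m U <= W)%MS -> ~~ (sign_vector (flip x) *m U <= W)%MS.
  move=> xW; apply/negP => fW.
  have zero y : (sign_vector y *m U <= W)%MS ->
      \sum_j (-1) ^+ y j * (U *m a) j 0 = 0 :> R.
    move=> /submxP[D yD].
    have : (sign_vector y *m (U *m a)) 0 0 = 0 by rewrite mulmxA yD -mulmxA Wa mulmx0 mxE.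
    rewrite mxE => e; rewrite -[RHS]e.
    by apply: eq_bigr => j _; rewrite [sign_vector _ _ _]mxE.
  have := zero _ xW; have := zero _ fW.
  rewrite (bigD1 i)//= [in X in _ -> X](bigD1 i)//= ffunE eqxx.
  rewrite (eq_bigr (fun j => (-1) ^+ x j * (U *m a) j 0)) => [|j ji]; last first.
    by rewrite ffunE (negbTE ji).
  rewrite signrN mulNr.
  have : (-1) ^+ x i * (U *m a) i 0 != 0 by rewrite mulf_neq0// signr_eq0.
  move: (_ * _) (\sum_(j < n | _) _) => p q p0 e1 e2.
  by move/eqP: p0; apply; lra.
set q := \sum_(x | _) _.
have q0 : q <= \sum_(x : {ffun 'I_n -> bool} | ~~ (sign_vector x *m U <= W)%MS) 2^-1 ^+ n.
  rewrite [leRHS](reindex_inj (inv_inj flipK))/=.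
  rewrite [leRHS](bigID (fun x => (sign_vector x *m U <= W)%MS))/= ler_wpDr//.
    by apply: sumr_ge0 => x _; rewrite exprn_ge0.
  rewrite le_eqVlt; apply/orP; left; apply/eqP; apply: eq_bigl => x.
  by have [/flipP ->|] := boolP (sign_vector x *m U <= W)%MS; rewrite ?andbF.
have := sum_sign_weight; rewrite (bigID (fun x => (sign_vector x *m U <= W)%MS))/= -/q.
by move=> q1; lra.
Qed.

(** With [d] the codimension, the worst mean is half of [2^d - 1] plus half of [2^(d-1) - 1], that
    is [3/4 * 2^d - 1]. *)
Lemma sign_step (W : 'M[R]_r) :
  \sum_(x : {ffun 'I_n -> bool}) 2^-1 ^+ n *
     (2 ^+ (r - \rank (W + sign_vector x *m U)%MS) - 1) <=
  3 / 4 * (2 ^+ (r - \rank W) - 1) :> R.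
Proof.
have [rW|rW] := eqVneq (\rank W) r.
  rewrite (rank_step_full (fun=> 2^-1 ^+ n) (fun x => sign_vector x *m U)
    (phi := fun k => 2 ^+ k - 1))//; last by rewrite subrr.
  by rewrite rW subnn subrr mulr0.
have {}rW : (\rank W < r)%N by rewrite ltn_neqAle rW rank_leq_row.
rewrite (rank_step_sum (fun x => sign_vector x *m U) sum_sign_weight
  (fun k => 2 ^+ k - 1))//.
have d0 : (0 < r - \rank W)%N by rewrite subn_gt0.
rewrite -(prednK d0); set e := (r - _).-1; rewrite /= exprS.
have e1 : 1 <= 2 ^+ e :> R by rewrite exprn_ege1// ler1n.
by have := sign_half rW; nra.
Qed.

End SignStep.

(** * Sign and leverage-score sketches *)

Section DiscreteSketches.
Context {R : realType} d (T : measurableType d) (P : probability T R).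
Context (n r : nat) (U : 'M[R]_(n, r)).
Hypothesis (UU : U^T *m U = 1%:M).

Lemma sign_law_singleton (b : bool) : @sign_law R [set (-1) ^+ b] = (2^-1)%:E.
Proof.
have N1 : (-1 : R) <> 1 by apply/eqP; rewrite eqNr oner_eq0.
have in1 (x y : R) : x = y -> (\d_x [set y] = 1 :> \bar R)%E.
  by move=> ->; rewrite diracE mem_set.
have notin (x y : R) : x <> y -> (\d_x [set y] = 0 :> \bar R)%E.
  by move=> xy; rewrite diracE memNset.
rewrite /sign_law; case: b; rewrite ?expr1 ?expr0.
  by rewrite (notin 1)// 1?in1// ?mule0 ?add0e ?mule1// => /esym.
by rewrite (in1 1)// (notin (-1))// mule0 adde0 mule1.
Qed.

Lemma sign_sketch_injective (t : nat) (X : 'I_t * 'I_n -> T -> R) :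
    iid P measurable sign_law X ->
  prob_ge P
    [set w | forall a : 'cV[R]_r, rescaled_matrix X w *m (U *m a) = 0 -> a = 0]
    (1 - (3 / 4) ^+ t * (2 ^+ r - 1)).
Proof.
move=> [mX indX lawX].
pose C (j : 'I_t) (x : {ffun 'I_n -> bool}) :=
  \bigcap_(i in [set: 'I_n]) (X (j, i) @^-1` [set (-1) ^+ x i]).
pose wt (x : {ffun 'I_n -> bool}) : R := 2^-1 ^+ n.
have inj_sign (b b' : bool) : (-1) ^+ b = (-1) ^+ b' :> R -> b = b'.
  by case: b b' => -[]//=; rewrite ?expr0 ?expr1; lra.
have := @prob_ge_spanning R d T P t _ C wt r (fun x => sign_vector x *m U)
  ((3 / 4) ^+ t * (2 ^+ r - 1)).
move=> H; apply: (prob_ge_weaken (lexx _)) (H _ _ _ _ _) => {H}.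
- move=> w [u su Cu] a Xa; apply: spanning_injective su _ => x xu.
  have [j ->] : exists j, x = tnth u j by exact/tnthP.
  apply/matrixP => i l; rewrite (ord1 i) (ord1 l) [RHS]mxE -mulmxA.
  (* The index [j] shows that [t > 0], so the rescaling is invertible. *)
  have t0 : (Num.sqrt t%:R)^-1 != 0 :> R.
    by rewrite invr_neq0// gt_eqF// sqrtr_gt0 ltr0n (leq_ltn_trans _ (ltn_ord j)).
  have /matrixP/(_ j 0) := Xa.
  rewrite /rescaled_matrix -scalemxAl [LHS]mxE [RHS]mxE => /eqP.
  rewrite mulf_eq0 (negbTE t0)/= => /eqP <-.
  rewrite [LHS]mxE [RHS]mxE; apply: eq_bigr => k _; rewrite [sign_vector _ _ _]mxE.
  by congr (_ * _); rewrite mxE; have -> := Cu j k I.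
- move=> j x; apply: fin_bigcap_measurable => // i _; exact: mX.
- move=> j x y w Cx Cy; apply/ffunP => i; apply: inj_sign.
  by rewrite -(Cx i I) -(Cy i I).
- move=> u.
  have -> : \bigcap_(j in [set: 'I_t]) C j (tnth u j) =
      \bigcap_(p in [set` finset.setT]) (X p @^-1` [set (-1) ^+ tnth u p.1 p.2]).
    apply/seteqP; split=> w H; first by move=> [j i] _; exact: (H j I i I).
    by move=> j _ i _; apply: (H (j, i)); rewrite /= inE.
  rewrite indX => [|p _]; last exact: measurable_set1.
  rewrite (eq_bigr (fun=> (2^-1)%:E)) => [|p _]; last first.
    by rewrite -(sign_law_singleton (tnth u p.1 p.2)); exact: lawX.
  rewrite prodEFin; congr EFin.
  rewrite big_tuple /wt !prodr_const cardsT card_prod !card_ord.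
  by rewrite mulnC exprM.
- exact: sum_sign_weight.
- apply: (not_spanning_weight_le (phi := fun k => 2 ^+ k - 1)).
  + by move=> x; rewrite exprn_ge0.
  + by [].
  + exact: sign_step.
  + by move=> k; rewrite subr_ge0 exprn_ege1// ler1n.
  + case=> // k _; rewrite exprS.
    have : 1 <= 2 ^+ k :> R by rewrite exprn_ege1// ler1n.
    by move=> ?; lra.
Qed.

Lemma leverage_sketch_injective (t : nat) (idx : 'I_t -> T -> 'I_n) :
    (0 < r)%N -> (0 < t)%N ->
    iid P discrete_measurable (index_law (leverage_prob U)) idx ->
  prob_ge P
    [set w | forall a : 'cV[R]_r, (forall j, row (idx j w) U *m a = 0) -> a = 0]
    (1 - (1 - r%:R^-1) ^+ t * r%:R).
Proof.
move=> r0 t0 [mI indI lawI].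
pose C (j : 'I_t) (i : 'I_n) := idx j @^-1` [set i].
(* The weights are the law of the first sample, which exists since [0 < t]. *)
have lev1 : \sum_i leverage_prob U i = 1.
  have := lawI (Ordinal t0) setT I; rewrite preimage_setT probability_setT => -[->].
  by apply: eq_bigl => i; rewrite mem_set.
have law1 i : index_law (leverage_prob U) [set i] = (leverage_prob U i)%:E.
  rewrite /index_law (bigD1 i) ?mem_set//= big1 ?addr0// => k /andP[/set_mem/= ->].
  by rewrite eqxx.
have := @prob_ge_spanning R d T P t _ C (leverage_prob U) r (fun i => row i U)
  ((1 - r%:R^-1) ^+ t * r%:R).
move=> H; apply: (prob_ge_weaken (lexx _)) (H _ _ _ _ _) => {H}.
- move=> w [u su Cu] a Ua; apply: spanning_injective su _ => x xu.
  have [j ->] : exists j, x = tnth u j by exact/tnthP.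
  by rewrite -(Cu j).
- by move=> j i; exact: mI.
- by move=> j x y w Cx Cy; rewrite -Cx -Cy.
- move=> u.
  have -> : \bigcap_(j in [set: 'I_t]) C j (tnth u j) =
      \bigcap_(j in [set` finset.setT]) (idx j @^-1` [set tnth u j]).
    by apply/seteqP; split=> w H j _; apply: (H j); rewrite /= ?inE.
  rewrite indI//.
  rewrite (eq_bigr (fun j => (leverage_prob U (tnth u j))%:E)) => [|j _]; last first.
    by rewrite -law1; exact: lawI.
  rewrite prodEFin; congr EFin; rewrite [RHS]big_tuple.
  by apply: eq_bigl => j; rewrite inE.
- exact: lev1.
- apply: (not_spanning_weight_le (phi := fun k => k%:R)).
  + by move=> i; rewrite divr_ge0// sqr_ge0.
  + by rewrite subr_ge0 invf_le1 ?ltr0n// ler1n.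
  + exact: leverage_step.
  + by [].
  + by move=> k k0; rewrite ler1n.
Qed.

End DiscreteSketches.

(** * The Gaussian sketch *)

Section Estimates.
Context {R : realType}.

Lemma expR1_ge2 : 2 <= expR 1 :> R.
Proof. by have := expR_ge1Dx (1 : R); rewrite -[1 + 1]/(2%:R). Qed.

(** By [2 <= expR 1] the net costs [18 * e] in the exponent and the factor 2 at most [e] more: 19 in
    all. *)
Lemma net_failure_le (e : nat) (C x : R) : (0 < e)%N -> (19 + C) * e%:R <= x ->
  (2 ^ (18 * e))%:R * (2 * expR (- x)) <= expR (- (C * e%:R)).
Proof.
move=> e0 Cx; have e1 : 1 <= e%:R :> R by rewrite ler1n.
apply: (@le_trans _ _ (expR (18 * e%:R) * (expR e%:R * expR (- x)))).
  rewrite ler_pM ?mulr_ge0 ?expR_ge0//.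
    rewrite natrX -natrM -[X in expR X]mulr1 expRM_natl.
    by rewrite lerXn2r ?nnegrE ?expR_ge0// expR1_ge2.
  rewrite ler_wpM2r ?expR_ge0// (le_trans expR1_ge2)// ler_expR//.
by rewrite -!expRD ler_expR; lra.
Qed.

(** [eps < 1/3] makes [1 / eps^2] at least 9. *)
Lemma eps_sqr_inv (eps x t K : R) : 0 < eps -> eps < 1 / 3 -> 0 <= x -> 0 <= K ->
  K * (x / eps ^+ 2) <= t -> 9 * (K * x) <= t.
Proof.
move=> e0 e3 x0 K0; apply: le_trans; rewrite [leRHS]mulrA ler_pdivlMr ?exprn_gt0//.
have e9 : eps ^+ 2 <= 1 / 9 by nra.
have Kx : 0 <= K * x by rewrite mulr_ge0.
nra.
Qed.

End Estimates.

Section GaussianSketch.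
Context {R : realType} d (T : measurableType d) (P : probability T R).
Context (n m r t : nat) (A : 'M[R]_(n, m)) (U : 'M[R]_(n, r)) (s : 'rV[R]_r).
Context (V : 'M[R]_(m, r)) (X : 'I_t * 'I_n -> T -> R).
Hypotheses (svd : is_svd A U s V).
Hypothesis iidX : iid P measurable (normal_prob 0 1) X.

Let UU : U^T *m U = 1%:M. Proof. by case: svd. Qed.

Lemma gaussian_sketch_exact (C : R) (k : nat) (a : R) :
    (0 < r)%N -> 0 < C -> (20 + C) * r%:R <= t%:R / 576 -> 1 <= a ->
  prob_ge P [set w | projected_approx_le A (rescaled_matrix X w *m A) k a]
    (1 - expR (- (C * r%:R))).
Proof.
move=> r0 C0 Ct a1.
have r1 : 1 <= r%:R :> R by rewrite ler1n.
have Cr : 0 < C * r%:R by rewrite mulr_gt0// ltr0n.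
have t0 : (0 < t)%N by rewrite -(ltr0n R); lra.
(* This [tau] gives distortion 1/2, hence injectivity, and the exponent
   [t * (1/6)^2 / 16 = t / 576]. *)
have tau0 : 0 < 1 / 6 :> R by [].
have := gaussian_near_isometry iidX t0 UU tau0.
apply: prob_ge_weaken.
  rewrite lerD2l lerN2 net_failure_le// min_l; lra.
move=> w iso; apply: (projected_approx_le_injective svd) => // x y AyE GAy.
have := iso x; rewrite -AyE mulmxA GAy sqn0 sub0r normrN ger0_norm ?sqn_ge0// => H.
by apply: sqn_eq0; have := sqn_ge0 x; lra.
Qed.

Lemma gaussian_sketch (c D eps : R) (k : nat) :
    0 < c -> 20 + c = D / 576 -> 0 < eps -> eps < 1 / 3 -> (1 <= k <= r)%N ->
    16 * D * (k%:R / eps ^+ 2) <= t%:R ->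
  prob_ge P
    [set w | projected_approx_le A (rescaled_matrix X w *m A) k
      (2 + eps * Num.sqrt ((r - k)%:R / k%:R))]
    (1 - expR (- (c * k%:R))).
Proof.
move=> c0 cD e0 e3 /andP[k0 kr] Kt.
set a := 2 + _.
have a2 : 2 <= a by rewrite lerDl mulr_ge0 ?sqrtr_ge0// ltW.
have r0 : (0 < r)%N by exact: leq_trans kr.
have k1 : 1 <= k%:R :> R by rewrite ler1n.
have kr' : k%:R <= r%:R :> R by rewrite ler_nat.
have D0 : 0 < D by lra.
have Kt9 : 9 * (16 * D * k%:R) <= t%:R.
  by apply: (eps_sqr_inv e0 e3 _ _ Kt); lra.
(* Above the threshold [D * r] the sketch is injective on all of [U] and nothing is lost. Below it,
   only the first [k] directions are nearly preserved. *)
have [Drt|tDr] := lerP (D * r%:R) t%:R.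
  have a1 : 1 <= a by lra.
  have Dr : (20 + c) * r%:R <= t%:R / 576 by rewrite cD; lra.
  apply: prob_ge_weaken (gaussian_sketch_exact k r0 c0 Dr a1) => //.
  by rewrite lerD2l lerN2 ler_expR lerN2 ler_pM2l.
have tR : 0 < t%:R :> R by nra.
have t0 : (0 < t)%N by rewrite -(ltr0n R).
have kltr : (k < r)%N by rewrite -(ltr_nat R); nra.
pose Uk := U *m first_coords r k.
have UkUk : Uk^T *m Uk = 1%:M.
  by rewrite trmx_mul -mulmxA (mulmxA U^T) UU mul1mx first_coords_isometry.
have tau6 : 0 < 1 / 6 :> R by [].
(* Chosen so that [t * tau = D * r], enough to beat a net in dimension [r]. As [tau > 1], the upper
   bound [1 + 3 * tau] is at most [4 * tau]. *)
pose tau := D * r%:R / t%:R.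
have tau1 : 1 < tau by rewrite ltr_pdivlMr ?mul1r.
have tau0 : 0 < tau by exact: lt_trans tau1.
have taut : t%:R * tau = D * r%:R by rewrite mulrC divfK// gt_eqF.
have isok := gaussian_near_isometry iidX t0 UkUk tau6.
have isor := gaussian_near_isometry iidX t0 UU tau0.
apply: prob_ge_weaken (prob_geI isok isor).
  rewrite lerD2l lerN2.
  (* The spare unit in [c + 1] absorbs the factor 2 from adding two failure probabilities. *)
  apply: (@le_trans _ _ (expR (- ((c + 1) * k%:R)) + expR (- ((c + 1) * r%:R)))).
    apply: lerD; apply: net_failure_le => //.
      have -> : c + 1 = D / 576 - 19 by lra.
      rewrite min_l; lra.
    rewrite min_r ?mul1r; last exact: ltW.
    have -> : c + 1 = D / 576 - 19 by lra.
    have Dr0 : 0 < D * r%:R by rewrite mulr_gt0// ltr0n.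
    by rewrite mulrA taut; lra.
  apply: (@le_trans _ _ (2 * expR (- ((c + 1) * k%:R)))).
    by rewrite mulr_natl mulr2n lerD2l ler_expR lerN2 ler_pM2l// addr_gt0.
  apply: (@le_trans _ _ (expR k%:R * expR (- ((c + 1) * k%:R)))).
    by rewrite ler_wpM2r ?expR_ge0// (le_trans expR1_ge2)// ler_expR.
  by rewrite -expRD ler_expR; lra.
move=> w [wk wr].
have H : projected_approx_le A (rescaled_matrix X w *m A) (Ordinal kltr)
    (2 + Num.sqrt (2 * (4 * tau))).
  apply: (projected_approx_le_svd svd) => [|b|b] /=.
  - by rewrite mulr_ge0// ltW.
  - by have := wk b; rewrite -/Uk ler_norml => /andP[? _]; lra.
  - have := wr b; rewrite ler_norml => /andP[_ wb].
    have := sqn_ge0 b => b0; nra.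
apply: projected_approx_le_mono H.
rewrite lerD2l.
have -> : eps * Num.sqrt ((r - k)%:R / k%:R) = Num.sqrt (eps ^+ 2 * ((r - k)%:R / k%:R)).
  by rewrite [RHS]sqrtrM ?sqr_ge0// sqrtr_sqr gtr0_norm.
rewrite ler_wsqrtr// /tau natrB//.
rewrite (_ : 2 * _ = 8 * D * r%:R / t%:R); last by ring.
rewrite [leRHS]mulrA ler_pdivrMr// [leRHS]mulrAC ler_pdivlMr; last by lra.
move: Kt; rewrite mulrA ler_pdivrMr ?exprn_gt0// => Kt.
have Dk0 : 0 <= D * k%:R by rewrite mulr_ge0// ltW.
(* Here [144 * D * k <= t < D * r], so [k] is small against [r] and [8 * r <= 16 * (r - k)]; with
   [16 * D * k <= t * eps^2] this bounds [8 * D * r / t] as wanted. *)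
have rk : 16 * k%:R <= r%:R :> R.
  by rewrite -(ler_pM2l D0); lra.
apply: (@le_trans _ _ ((r%:R - k%:R) * (16 * D * k%:R))).
  rewrite (_ : 8 * D * r%:R * k%:R = D * k%:R * (8 * r%:R)); last by ring.
  rewrite (_ : _ * (16 * D * k%:R) = D * k%:R * (16 * (r%:R - k%:R))); last by ring.
  by rewrite ler_wpM2l//; lra.
rewrite (_ : eps ^+ 2 * _ * _ = (r%:R - k%:R) * (t%:R * eps ^+ 2)); last by ring.
by rewrite ler_wpM2l//; lra.
Qed.

End GaussianSketch.

(** * Choice of the constant and assembly of the three sampling schemes *)

Theorem theorem3p5 (R : realType) (c : R) (hc : 0 < c) :
  exists2 K : R, 0 < K &
  forall (eps : R) (n m r : nat) (A : 'M[R]_(n, m)) (U : 'M[R]_(n, r))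
    (s : 'rV[R]_r) (V : 'M[R]_(m, r)),
  0 < eps -> eps < 1 / 3 -> (m <= n)%N -> \rank A = r -> is_svd A U s V ->
  [/\ (forall (t : nat) (d : measure_display) (T : measurableType d)
         (P : probability T R) (X : 'I_t * 'I_n -> T -> R),
       K * (r%:R / eps ^+ 2) <= t%:R ->
       iid P measurable sign_law X ->
       prob_ge P
         [set w | forall k : nat, (1 <= k <= r)%N ->
            projected_approx_le A
              (rescaled_matrix X w *m A) k (1 + eps)]
         (1 - expR (- (c * r%:R)))),
      (forall (k t : nat) (d : measure_display) (T : measurableType d)
         (P : probability T R) (X : 'I_t * 'I_n -> T -> R),
       (1 <= k <= r)%N ->
       K * (k%:R / eps ^+ 2) <= t%:R ->
       iid P measurable (normal_prob 0 1) X ->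
       prob_ge P
         [set w | projected_approx_le A
              (rescaled_matrix X w *m A) k
              (2 + eps * Num.sqrt ((r - k)%:R / k%:R))]
         (1 - expR (- (c * k%:R))))
    & (forall (t : nat) (d : measure_display) (T : measurableType d)
         (P : probability T R) (idx : 'I_t -> T -> 'I_n),
       K * (r%:R * ln (r%:R / eps ^+ 2) / eps ^+ 2) <= t%:R ->
       iid P discrete_measurable (index_law (leverage_prob U)) idx ->
       prob_ge P
         [set w | forall k : nat, (1 <= k <= r)%N ->
            projected_approx_le A
              (sampled_rows A (leverage_prob U) (fun j => idx j w)) k
              (1 + eps)]
         (1 - (r%:R / eps ^+ 2) `^ (- c)))].
Proof.
(* [576] inverts the rate [t / 576] of the Gaussian estimate at distortion 1/2; the factor 16 in [K]
   serves the comparison with [eps^2 * (r - k) / k]. *)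
have [D D0 cD] : exists2 D : R, 0 < D & 20 + c = D / 576.
  by exists (576 * (20 + c)); [lra|field].
have K0 : 0 < 16 * D by lra.
exists (16 * D) => //; move: K0; set K := 16 * D => K0.
move=> eps n m r A U s V e0 e3 _ _ svd; have [UU _ _ _ _] := svd.
have cK : c + 1 <= K by rewrite /K; lra.
have e1 : 1 <= 1 + eps by rewrite lerDl ltW.
(* In rank 0 no [k] lies in the range, so the first and third events are the whole space. *)
have [rE|r0] := posnP r.
  split=> [t d T P X _ _|k t d T P X|t d T P idx _ _].
  - exists setT; split=> [//|w _ k /andP[k0 /(leq_trans k0) r1]|].
      by rewrite rE in r1.
    rewrite probability_setT lee_fin; have := expR_ge0 (- (c * r%:R)); lra.
  - by move=> /andP[k0 /(leq_trans k0) r1]; rewrite rE in r1.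
  - exists setT; split=> [//|w _ k /andP[k0 /(leq_trans k0) r1]|].
      by rewrite rE in r1.
    rewrite probability_setT lee_fin; have := powR_ge0 (r%:R / eps ^+ 2) (- c); lra.
have r1 : 1 <= r%:R :> R by rewrite ler1n.
split=> [t d T P X Kt iidX|k t d T P X kr Kt iidX|t d T P idx Kt iidI].
- apply: prob_ge_weaken (sign_sketch_injective UU iidX); last first.
    move=> w inj k _; apply: (projected_approx_le_injective svd) => // x y AyE GAy.
    by apply: inj; rewrite -AyE mulmxA.
  have K9 : 9 * (K * r%:R) <= t%:R by apply: eps_sqr_inv e0 e3 _ _ Kt; lra.
  rewrite lerD2l lerN2.
  (* [3/4 <= expR (- 1/4)] and [2 <= expR 1] bound the failure by [expR (r - t / 4)]. *)
  apply: (@le_trans _ _ (expR (- (t%:R / 4)) * expR r%:R)).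
    rewrite ler_pM ?exprn_ge0 ?subr_ge0 ?exprn_ege1 ?ler1n//.
      rewrite -mulrN expRM_natl lerXn2r ?nnegrE ?expR_ge0//.
      by have := expR_ge1Dx (- 4^-1 : R); lra.
    rewrite -[X in expR X]mulr1 expRM_natl.
    have : 2 ^+ r <= expR 1 ^+ r :> R.
      by rewrite lerXn2r ?nnegrE ?expR_ge0// expR1_ge2.
    lra.
  rewrite -expRD ler_expR; rewrite /K in K9; nra.
- exact: (gaussian_sketch svd iidX hc cD e0 e3 kr Kt).
- set x := r%:R / eps ^+ 2 in Kt *.
  have e9 : eps ^+ 2 <= 1 / 9 by nra.
  have ee0 : 0 < eps ^+ 2 by rewrite exprn_gt0.
  have rx : r%:R <= x by rewrite ler_pdivlMr//; nra.
  have x9 : 9 <= x by rewrite ler_pdivlMr//; nra.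
  have x0 : 0 < x by lra.
  have L0 : 0 < ln x by rewrite ln_gt0//; lra.
  have Kt9 : 9 * (K * (r%:R * ln x)) <= t%:R.
    by apply: eps_sqr_inv e0 e3 _ _ Kt => //; rewrite mulr_ge0// ltW.
  have t0 : (0 < t)%N.
    have Kr : 0 < K * (r%:R * ln x) by rewrite !mulr_gt0// ltr0n.
    by rewrite -(ltr0n R); lra.
  apply: prob_ge_weaken (leverage_sketch_injective UU r0 t0 iidI).
    rewrite lerD2l lerN2.
    (* The failure [(1 - 1/r)^t * r] is at most [expR (- t / r) * x], so [c + 1] multiples of [ln x]
       leave [x] to the power [- c]. *)
    have rt : (c + 1) * ln x <= t%:R / r%:R.
      rewrite ler_pdivlMr ?ltr0n//; rewrite /K in Kt9.
      have : 0 < ln x * r%:R by rewrite mulr_gt0// ltr0n.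
      nra.
    apply: (@le_trans _ _ (expR (- (t%:R / r%:R)) * expR (ln x))).
      rewrite ler_pM ?exprn_ge0 ?subr_ge0 ?invf_le1 ?ltr0n//.
        rewrite -mulrN expRM_natl lerXn2r ?nnegrE ?expR_ge0//.
          by rewrite subr_ge0 invf_le1 ?ltr0n.
        by have := expR_ge1Dx (- r%:R^-1 : R).
      by rewrite lnK// posrE.
    rewrite -expRD /powR gt_eqF// ler_expR; lra.
  move=> w inj k _; apply: (projected_approx_le_injective svd) => // z y AyE SAy.
  apply: inj => j.
  (* At a zero weight the scaling is the inverse of 0, which is 0, so the sampled row carries no
     information; but then the row of [U] itself vanishes. *)
  have [p0|p0] := eqVneq (leverage_prob U (idx j w)) 0.
    suff -> : row (idx j w) U = 0 by rewrite mul0mx.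
    apply: trmx_inj; rewrite trmx0; apply: sqn_eq0; apply/eqP.
    by move/eqP: p0; rewrite mulf_eq0 invr_eq0 pnatr_eq0 (gtn_eqF r0) orbF l2norm_sqr_row.
  have p_gt0 : 0 < leverage_prob U (idx j w).
    by rewrite lt_neqAle eq_sym p0 divr_ge0// sqr_ge0.
  rewrite -row_mul -AyE row_mul.
  have : row j (sampled_rows A (leverage_prob U) (idx^~ w) *m y) = 0 by rewrite SAy row0.
  rewrite row_mul rowK -scalemxAl => /eqP; rewrite scaler_eq0 invr_eq0 gt_eqF.
    by move=> /eqP.
  by rewrite sqrtr_gt0 mulr_gt0// ltr0n.
Qed.
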